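(* Let $p>3$ be a prime. If $p\equiv 1\pmod 3$ and $4p=x^2+27y^2$ with $x,y\in\mathbb{Z}$, then $$\sum_{k=0}^{p-1}\frac{\binom{2k}{k}^2\binom{3k}{k}}{(-192)^k}\equiv x^2-2p\pmod{p^2}.$$ If $p\equiv 2\pmod 3$, then $$\sum_{k=0}^{p-1}\frac{\binom{2k}{k}^2\binom{3k}{k}}{(-192)^k}\equiv 0\pmod{p^2}.$$
   Context: Congruences modulo $p^2$ between rational numbers whose denominators are prime to $p$ are understood in the ring $\mathbb{Z}_p$ of $p$-adic integers (equivalently, in the localization $\mathbb{Z}_{(p)}$). *)

(* Defs.v *)
From HB Require Import structures.
From mathcomp Require Import all_boot all_order all_algebra.

Set Implicit Arguments.
Unset Strict Implicit.
Unset Printing Implicit Defensive.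

Import Order.TTheory GRing.Theory Num.Theory.
Local Open Scope ring_scope.

(* The localization Z_(p), as a subset of Q; [denq] is the positive
   denominator of the reduced fraction. *)
Definition Zloc (p : nat) : pred rat := [pred r | coprime p `|denq r|%N].

(* Congruence in the ring Z_(p): both sides are required to lie in Z_(p), and
   their difference to lie in the ideal m Z_(p). *)
Definition Zloc_congr (p m : nat) (a b : rat) : Prop :=
  [/\ a \in Zloc p, b \in Zloc p
    & exists2 c : rat, c \in Zloc p & a - b = m%:R * c].

(* Main.v *)
Require Import Defs.
From HB Require Import structures.
From mathcomp Require Import all_boot all_order all_algebra all_field.
From mathcomp Require Import ring lra zify.

Set Implicit Arguments.
Unset Strict Implicit.
Unset Printing Implicit Defensive.

Import Order.TTheory GRing.Theory Num.Theory.
Local Open Scope ring_scope.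

(* Write a_k = C(2k,k) C(3k,k), c_k = C(2k,k)^2 C(3k,k) and
   y = x (1 - 27 x).

   A Clausen-type identity says that (sum_k a_k x^k)^2 and sum_k c_k y^k have
   the same coefficients in degree < p once both sums are truncated at k < p;
   the coefficients of higher degree vanish modulo p^2.  At x = 1/24, where
   y = -1/192, the sum of the theorem is thus S^2 modulo p^2, where S is the
   truncation of 2F1(1/3, 2/3; 1; 9/8).

   The terms of 2F1(1/3 + tp, 2/3 + tp; 1 + 3tp; 9/8) are affine in t modulo
   p^2, so that S = 2 S(-1/3) - S(-2/3).  Along this family a contiguity
   relation, obtained by creative telescoping, evaluates the terminating series
   in closed form.  For p = 3n + 2 this gives p | S.  For p = 3n + 1 one finds
   S(-1/3) = C v and S(-2/3) = C v^2 with C = C(2n,n) and v = 1 modulo p,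
   hence S = C modulo p^2.

   Finally, -C is modulo p^2 the unit cubic Jacobi sum J', computed through the
   Teichmueller character; its conjugate J satisfies J J' = p, and J + J' is an
   integer A with 4p = A^2 + 27 B^2, so that S^2 = J'^2 = A^2 - 2p = x^2 - 2p. *)

(** * A closed form at argument 9/8 *)

Ltac neq0_lra h := by apply: contraNneq h => ?; apply/eqP; lra.

(* General term of 2F1(1/3 + x, 2/3 + x; 1 + 3x; 9/8). *)
Definition tau (R : unitRingType) (x : R) (k : nat) : R :=
  \prod_(j < k) ((3^-1 + j%:R + x) * (2 / 3 + j%:R + x)
     / ((1 + j%:R + 3 * x) * (1 + j%:R)) * (9 / 8)).

Lemma tau0 (R : unitRingType) (x : R) : tau x 0 = 1.
Proof. by rewrite /tau big_ord0. Qed.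

Lemma tauS (R : unitRingType) (x : R) k :
  tau x k.+1 = tau x k * ((3^-1 + k%:R + x) * (2 / 3 + k%:R + x)
     / ((1 + k%:R + 3 * x) * (1 + k%:R)) * (9 / 8)).
Proof. by rewrite /tau big_ord_recr. Qed.

Definition rising (R : nzRingType) (x : R) (k : nat) : R :=
  \prod_(j < k) (x + j%:R).

Lemma risingS (R : nzRingType) (x : R) k :
  rising x k.+1 = rising x k * (x + k%:R).
Proof. by rewrite /rising big_ord_recr. Qed.

Lemma risingSl (R : nzRingType) (x : R) k :
  rising x k.+1 = x * rising (1 + x) k.
Proof.
rewrite /rising big_ord_recl addr0; congr (_ * _); apply: eq_bigr => i _.
by rewrite /= /bump /= add1n -natr1 addrA [1 + x]addrC addrAC.
Qed.

Section Contiguity.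

Variable x : rat.

(** Replacing [x] by [x - 1] lowers the numerator parameters by 1 and the parameter [1 + 3 x] by 3.
    The factors [3 x - 1] and [3 x - 2] then cancel, and only a simple rational factor remains. *)
Lemma tau_shift k :
  (forall j, (j < k.+1)%N -> 3 * x - 2 + j%:R != 0) ->
  (forall j, (j < k)%N -> 1 + j%:R + 3 * x != 0) ->
  12 * x * tau (x - 1) k.+1
    = (3 * x + k%:R) * (3 * x + k%:R - 1) / (2 * (k%:R + 1)) * tau x k.
Proof.
elim: k => [|k IH] H1 H2.
  rewrite tauS !tau0 /=.
  have h0 := H1 0%N isT.
  by field; neq0_lra h0.
rewrite tauS (mulrA _ (tau _ _)) {}IH; first last.
- by move=> j jk; apply: H2; apply: ltnW.
- by move=> j jk; apply: H1; apply: ltnW.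
rewrite tauS -!natr1.
have h1 := H1 k.+1 (ltnSn _).
have h2 := H2 k (ltnSn _).
have k0 : 0 <= k%:R :> rat by [].
rewrite -natr1 in h1.
field.
by rewrite -?andbA; do ?[apply/andP; split]; first [neq0_lra h1 | neq0_lra h2 | apply/eqP; lra].
Qed.

(** The last summand is the telescoping certificate. Being a multiple of [tau x K], it vanishes past
    the end of a terminating series, which leaves a two-term recurrence. *)
Lemma sum_tau_shift K :
  (forall j, (j < K)%N -> 3 * x - 2 + j%:R != 0) ->
  (forall j, (j < K)%N -> 1 + j%:R + 3 * x != 0) ->
  12 * x * (\sum_(k < K.+1) tau (x - 1) k)
  = (6 * x - 1) * (\sum_(k < K.+1) tau x k) + (4 * K%:R + 1 + 6 * x) * tau x K.
Proof.
elim: K => [|K IH] H1 H2.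
  by rewrite !big_ord_recr !big_ord0 /= !tau0; ring.
rewrite big_ord_recr [in RHS]big_ord_recr /= mulrDr {}IH; first last.
- by move=> j jk; apply: H2; apply: ltnW.
- by move=> j jk; apply: H1; apply: ltnW.
rewrite tau_shift //; last by move=> j jk; apply: H2; apply: ltnW.
rewrite tauS -!natr1.
have h2 := H2 K (ltnSn _).
have k0 : 0 <= K%:R :> rat by [].
field.
by rewrite -?andbA; do ?[apply/andP; split]; first [neq0_lra h2 | apply/eqP; lra].
Qed.

End Contiguity.

(* For these [x] the series terminates: one numerator parameter is [- m].  A
   vanishing denominator can only occur at or beyond that parameter's zero, where
   the term is [0] in any case since [0^-1 = 0]. *)
Lemma tau_eq0 (x : rat) m k : x = - m%:R - 3^-1 \/ x = - m%:R - 2 / 3 ->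
  (m < k)%N -> tau x k = 0.
Proof.
move=> Hx; elim: k => // k IH; rewrite ltnS leq_eqVlt tauS => /orP[/eqP <-|/IH -> ]; last by rewrite mul0r.
have -> : (3^-1 + m%:R + x) * (2 / 3 + m%:R + x) = 0 by case: Hx => ->; field.
by rewrite !(mul0r, mulr0).
Qed.

Lemma sum_tau_trunc (x : rat) m K :
  x = - m%:R - 3^-1 \/ x = - m%:R - 2 / 3 ->
  (m < K)%N -> \sum_(k < K) tau x k = \sum_(k < m.+1) tau x k.
Proof.
move=> Hx mK; rewrite -(subnKC mK) big_split_ord /= [X in _ + X]big1 ?addr0 //.
by move=> i _; apply: tau_eq0 Hx _; rewrite leq_addr.
Qed.

Lemma sum_tau_contig (x : rat) m :
  (0 < m)%N -> x = - m%:R - 3^-1 \/ x = - m%:R - 2 / 3 ->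
  \sum_(k < m.+2) tau (x - 1) k
    = (6 * x - 1) / (12 * x) * \sum_(k < m.+1) tau x k.
Proof.
move=> m_gt0 Hx.
have m1 : 1 <= m%:R :> rat by rewrite ler1n.
have x0 : 12 * x != 0 by apply/eqP; case: Hx; lra.
(* Take [K = m.+1]. Positivity of [m] keeps [1 + j + 3 x] away from 0: for [x = - m - 1/3] it equals
   [j - 3 m]. *)
apply: (mulfI x0); rewrite sum_tau_shift; first last.
- move=> j; rewrite ltnS -(ler_nat rat) => jm; apply/eqP; case: Hx; lra.
- move=> j; rewrite ltnS -(ler_nat rat) => jm; apply/eqP; case: Hx; lra.
rewrite (tau_eq0 Hx (ltnSn m)) big_ord_recr /= (tau_eq0 Hx (ltnSn m)) addr0.
by rewrite mulr0 addr0 mulrA mulrCA divff // mulr1.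
Qed.

Lemma rising_neq0 (x : rat) k : 0 < x -> rising x k != 0.
Proof.
move=> x0; apply/prodf_neq0 => i _; apply: lt0r_neq0.
by apply: ltr_wpDr.
Qed.

(** Induction with the ratio [(6 x - 1) / (12 x)] of [sum_tau_contig] at [x = - m - 2/3], starting
    at the smallest [m] which that relation admits. *)
Lemma sum_tau_23 m : (0 < m)%N ->
  \sum_(k < m.+1) tau (- m%:R - 2 / 3 : rat) k
    = rising (m%:R + 2 / 3) m / (8 ^+ m * rising 3^-1 m).
Proof.
case: m => // m _; elim: m => [|m IH].
  rewrite !big_ord_recr big_ord0 /= !tauS tau0 /rising !big_ord_recr !big_ord0 /=.
  by field.
have -> : - m.+2%:R - 2 / 3 = (- m.+1%:R - 2 / 3) - 1 :> rat
  by rewrite -[m.+2%:R]natr1; ring.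
rewrite sum_tau_contig //; last by right.
rewrite {}IH [in RHS]exprS [in X in _ = _ / X]risingS.
have m0 : 0 <= m%:R :> rat by [].
have E : (m.+1%:R + 2 / 3) * rising (m.+2%:R + 2 / 3) m.+2 =
   rising (m.+1%:R + 2 / 3) m.+1 * (2 * m.+1%:R + 2/3) * (2 * m.+1%:R + 2/3 + 1) :> rat.
  rewrite /rising big_ord_recr /= mulrA.
  have -> : (m.+1%:R + 2 / 3) * \prod_(i < m.+1) (m.+2%:R + 2 / 3 + i%:R) =
      \prod_(i < m.+2) (m.+1%:R + 2 / 3 + i%:R) :> rat.
    rewrite [RHS]big_ord_recl /= addr0; congr (_ * _); apply: eq_bigr => i _.
    by rewrite /bump /= add1n -!natr1; ring.
  by rewrite big_ord_recr /= -!natr1; ring.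
have E' : rising (m.+2%:R + 2 / 3) m.+2 =
    rising (m.+1%:R + 2 / 3) m.+1 * (2 * m.+1%:R + 2/3) * (2 * m.+1%:R + 2/3 + 1)
    / (m.+1%:R + 2 / 3) :> rat.
  by rewrite -E mulrAC divff ?mul1r // -natr1; apply/eqP; lra.
rewrite E'.
have h1 : 8 ^+ m.+1 != 0 :> rat by rewrite expf_neq0.
have h2 : rising 3^-1 m.+1 != 0 :> rat by apply: rising_neq0.
rewrite -natr1; field.
by rewrite h2 h1 /= ?andbT; do ?[apply/andP; split]; apply/eqP; lra.
Qed.

Lemma sum_tau_13 n : (0 < n)%N ->
  \sum_(k < n.+1) tau (- n%:R - 3^-1 : rat) k
    = (2 * n)`!%:R / (8 ^+ n * n`!%:R * rising 3^-1 n).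
Proof.
case: n => // n _; elim: n => [|n IH].
  rewrite !big_ord_recr big_ord0 /= !tauS tau0 /rising !big_ord_recr !big_ord0 /=.
  by rewrite (_ : (2 * 1)`! = 2%N) // fact0 ?factS; field.
have -> : - n.+2%:R - 3^-1 = (- n.+1%:R - 3^-1) - 1 :> rat
  by rewrite -[n.+2%:R]natr1; ring.
rewrite sum_tau_contig //; last by left.
rewrite {}IH [in RHS]exprS [in X in _ = _ / X]risingS.
have n0 : 0 <= n%:R :> rat by [].
have -> : (2 * n.+2)`! = ((2 * n.+1).+2 * ((2 * n.+1).+1 * (2 * n.+1)`!))%N.
  by rewrite -!factS; congr _`!; lia.
rewrite (factS n.+1).
have h1 : 8 ^+ n.+1 != 0 :> rat by rewrite expf_neq0.
have h2 : rising 3^-1 n.+1 != 0 :> rat by apply: rising_neq0.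
have h3 : n.+1`!%:R != 0 :> rat by rewrite pnatr_eq0 -lt0n fact_gt0.
move: (2 * n.+1)`! (n.+1)`! h3 => f2 f1 h3.
have -> : (2 * n.+1).+2 = (2 * n + 4)%N by lia.
have -> : (2 * n.+1).+1 = (2 * n + 3)%N by lia.
rewrite !natrM !natrD ?natrM -!natr1; field.
by rewrite h3 h2 h1 /= ?andbT; do ?[apply/andP; split]; apply/eqP; lra.
Qed.

(** * The Clausen-type identity *)

Definition acoef (k : nat) : nat := ('C(2 * k, k) * 'C(3 * k, k))%N.
Definition ccoef (k : nat) : nat := ('C(2 * k, k) ^ 2 * 'C(3 * k, k))%N.

Lemma acoef_fact k : (acoef k * k`! ^ 3 = (3 * k)`!)%N.
Proof.
have /bin_fact h2 : (k <= 2 * k)%N by lia.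
have /bin_fact h3 : (k <= 3 * k)%N by lia.
rewrite -h3 (_ : 3 * k - k = 2 * k)%N; last by lia.
rewrite -h2 (_ : 2 * k - k = k)%N /acoef; last by lia.
ring.
Qed.

Lemma ccoef_fact k : (ccoef k * k`! ^ 5 = (2 * k)`! * (3 * k)`!)%N.
Proof.
have /bin_fact h2 : (k <= 2 * k)%N by lia.
have /bin_fact h3 : (k <= 3 * k)%N by lia.
rewrite -h3 (_ : 3 * k - k = 2 * k)%N; last by lia.
rewrite -h2 (_ : 2 * k - k = k)%N /ccoef; last by lia.
ring.
Qed.

Lemma acoefS k :
  ((k.+1 ^ 2) * acoef k.+1 = 3 * (3 * k + 1) * (3 * k + 2) * acoef k)%N.
Proof.
have k0 : (0 < k.+1 * k`! ^ 3)%N by rewrite muln_gt0 expn_gt0 fact_gt0.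
apply/eqP; rewrite -(eqn_pmul2r k0); apply/eqP.
have -> : (k.+1 ^ 2 * acoef k.+1 * (k.+1 * k`! ^ 3) = acoef k.+1 * k.+1`! ^ 3)%N.
  by rewrite factS; ring.
rewrite acoef_fact (_ : 3 * k.+1 = (3 * k).+3)%N; last by lia.
by rewrite !factS -acoef_fact; ring.
Qed.

Lemma ccoefS k :
  ((k.+1 ^ 3) * ccoef k.+1
     = 6 * (2 * k + 1) * (3 * k + 1) * (3 * k + 2) * ccoef k)%N.
Proof.
have k0 : (0 < k.+1 ^ 2 * k`! ^ 5)%N by rewrite muln_gt0 !expn_gt0 fact_gt0.
apply/eqP; rewrite -(eqn_pmul2r k0); apply/eqP.
have -> : (k.+1 ^ 3 * ccoef k.+1 * (k.+1 ^ 2 * k`! ^ 5) = ccoef k.+1 * k.+1`! ^ 5)%N.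
  by rewrite factS; ring.
rewrite ccoef_fact (_ : 3 * k.+1 = (3 * k).+3)%N; last by lia.
rewrite (_ : 2 * k.+1 = (2 * k).+2)%N; last by lia.
rewrite !factS.
transitivity (6 * (2 * k + 1) * (3 * k + 1) * (3 * k + 2) * k.+1 ^ 2
  * ((2 * k)`! * (3 * k)`!))%N; first by ring.
by rewrite -ccoef_fact; ring.
Qed.

Lemma acoefSr (k : nat) :
  (k%:R + 1) ^+ 2 * (acoef k.+1)%:R
    = 3 * (3 * k%:R + 1) * (3 * k%:R + 2) * (acoef k)%:R :> rat.
Proof.
transitivity (((k.+1 ^ 2) * acoef k.+1)%:R : rat); first by ring.
by rewrite acoefS; ring.
Qed.

Lemma ccoefSr (k : nat) :
  (k%:R + 1) ^+ 3 * (ccoef k.+1)%:R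
    = 6 * (2 * k%:R + 1) * (3 * k%:R + 1) * (3 * k%:R + 2) * (ccoef k)%:R :> rat.
Proof.
transitivity (((k.+1 ^ 3) * ccoef k.+1)%:R : rat); first by ring.
by rewrite ccoefS; ring.
Qed.

Section Clausen.

Local Notation "''D' f" := ('X * deriv f) (at level 10, f at level 9).

Implicit Types P U W : {poly rat}.

Lemma coef_euler P m : ('D P)`_m = m%:R * P`_m.
Proof.
by rewrite coefXM; case: m => [|m]; rewrite ?mul0r //= coef_deriv mulr_natl.
Qed.

Lemma eulerB P U : 'D (P - U) = 'D P - 'D U.
Proof. by rewrite derivB mulrBr. Qed.

Lemma deriv_1subX n : (1 - n%:R * 'X : {poly rat})^`() = - n%:R.
Proof.
by rewrite derivB -[X in X^`() - _]polyC1 derivC mulr_natl derivMn derivX sub0r.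
Qed.

Lemma coef_natM n P m : (n%:R * P)`_m = n%:R * P`_m.
Proof. by rewrite !mulr_natl coefMn. Qed.

Lemma dvdXnP N P : reflect (forall m, (m < N)%N -> P`_m = 0) ('X^N %| P).
Proof.
apply: (iffP idP) => [/dvdpP[Q ->] m mN|H]; first by rewrite coefMXn mN.
rewrite -(poly_take_drop N P) dvdp_addr ?dvdp_mull //.
suff -> : take_poly N P = 0 by rewrite dvdp0.
by apply/polyP => m; rewrite coef_take_poly coef0; case: ifP => // /H.
Qed.

(* The third-order equation of the symmetric square, as a first-order system
   in [A ^ 2] and [('D A) ^ 2], for [A] solving
   [(1 - 27 X) 'D 'D A = 27 X 'D A + 6 X A]. *)
Definition sym_square_system N U W :=
  'X^N %| (1 - 27 * 'X) * ('D ('D U) - 2 * W) - 27 * 'X * 'D U - 12 * 'X * U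
  /\ 'X^N %| (1 - 27 * 'X) * 'D W - 54 * 'X * W - 6 * 'X * 'D U.

(** In degree [m.+1] the second equation determines [(m + 1) W_(m+1)] and the first then
    [(m + 1)^2 U_(m+1)] from lower coefficients, so the constant term of [U] fixes everything. *)
Lemma sym_square_system_eq0 N U W : U`_0 = 0 -> sym_square_system N U W ->
  forall m, (m < N)%N -> U`_m = 0.
Proof.
move=> U0 [/dvdXnP H1 /dvdXnP H2].
suff H m : (m < N)%N -> U`_m = 0 /\ W`_m = 0 by move=> m /H[].
have E1 P : (1 - 27 * 'X) * P = P - 27 * ('X * P) by ring.
elim: m => [|m IH] mN.
  (* In degree 0 the first equation reads [- 2 W_0 = 0], since the Euler operator kills
     constants. *)
  split=> //; have := H1 0%N mN.
  rewrite E1 -!mulrA !(coefB, coef_natM, coef_euler, coefXM) /=.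
  lra.
have [Um Wm] := IH (ltnW mN).
have := H2 _ mN; have := H1 _ mN.
rewrite !E1 -!mulrA !(coefB, coef_natM, coef_euler, coefXM) /= Um Wm.
rewrite !(mulr0, subr0) => e1 e2.
have m0 : m.+1%:R != 0 :> rat by rewrite pnatr_eq0.
have W0 : W`_m.+1 = 0 by apply: (mulfI m0); rewrite mulr0.
split=> //; move: e1; rewrite W0 mulr0 subr0 => e1.
by apply: (mulfI m0); apply: (mulfI m0); rewrite !mulr0.
Qed.

Lemma sym_square_systemB N U W U' W' : sym_square_system N U W ->
  sym_square_system N U' W' -> sym_square_system N (U - U') (W - W').
Proof.
move=> [h1 h2] [h1' h2']; split.
- have -> : (1 - 27 * 'X) * ('D ('D (U - U')) - 2 * (W - W'))
     - 27 * 'X * 'D (U - U') - 12 * 'X * (U - U') =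
   ((1 - 27 * 'X) * ('D ('D U) - 2 * W) - 27 * 'X * 'D U - 12 * 'X * U) -
   ((1 - 27 * 'X) * ('D ('D U') - 2 * W') - 27 * 'X * 'D U' - 12 * 'X * U').
    by rewrite !eulerB; ring.
  exact: dvdp_sub.
have -> : (1 - 27 * 'X) * 'D (W - W') - 54 * 'X * (W - W') - 6 * 'X * 'D (U - U')
  = ((1 - 27 * 'X) * 'D W - 54 * 'X * W - 6 * 'X * 'D U) -
    ((1 - 27 * 'X) * 'D W' - 54 * 'X * W' - 6 * 'X * 'D U').
  by rewrite !eulerB; ring.
exact: dvdp_sub.
Qed.

Definition apoly N : {poly rat} := \poly_(k < N) (acoef k)%:R.

(** Coefficientwise this is the recurrence of [acoef]; the truncation only affects degree [N] and
    above. *)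
Lemma apoly_ode N : 'X^N %|
  (1 - 27 * 'X) * 'D ('D (apoly N)) - 27 * 'X * 'D (apoly N) - 6 * 'X * apoly N.
Proof.
apply/dvdXnP => m mN.
have E1 P : (1 - 27 * 'X) * P = P - 27 * ('X * P) by ring.
rewrite E1 -!mulrA !(coefB, coef_natM, coef_euler, coefXM) /=.
case: m mN => [|m] mN /=; first by rewrite !(mul0r, mulr0, subr0).
rewrite !coef_poly mN (ltnW mN).
have := acoefSr m; rewrite -natr1 => e.
by lra.
Qed.

(** With [L] the left side of the equation of [apoly], the two expressions are exactly [2 A L] and
    [2 ('D A) L]. *)
Lemma apoly_system N : sym_square_system N (apoly N ^+ 2) ('D (apoly N) ^+ 2).
Proof.
have := apoly_ode N; set A := apoly N; set L := (X in 'X^N %| X) => LN.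
have e (P : {poly rat}) : 'X * (P ^+ 2)^`() = 2 * P * 'D P by rewrite expr2 derivM; ring.
split.
- have -> : (1 - 27 * 'X) * ('D ('D (A ^+ 2)) - 2 * 'D A ^+ 2) - 27 * 'X * 'D (A ^+ 2)
      - 12 * 'X * A ^+ 2 = 2 * A * L.
    rewrite !e -mulrA (_ : (2 * (A * 'D A))^`() = 2 * (A^`() * 'D A + A * ('D A)^`())).
      by rewrite /L; ring.
    by rewrite !mulr_natl derivMn derivM.
  exact: dvdp_mull.
have -> : (1 - 27 * 'X) * 'D ('D A ^+ 2) - 54 * 'X * 'D A ^+ 2 - 6 * 'X * 'D (A ^+ 2)
  = 2 * 'D A * L by rewrite !e /L; ring.
exact: dvdp_mull.
Qed.

Local Notation q := (1 - 27 * 'X : {poly rat}).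
Local Notation y := ('X * q).

Lemma polyC_natM n (c : rat) : (n%:R * c)%:P = n%:R * c%:P :> {poly rat}.
Proof. by rewrite !mulr_natl polyCMn. Qed.

Lemma polyC_comb (n4 n3 n2 n1 : nat) (c4 c3 c2 c1 : rat) (Y : {poly rat}) :
  (n4%:R * c4 + n3%:R * c3 + n2%:R * c2 + n1%:R * c1)%:P * Y
  = n4%:R * (c4%:P * Y) + n3%:R * (c3%:P * Y) + n2%:R * (c2%:P * Y)
    + n1%:R * (c1%:P * Y).
Proof. by rewrite 3!polyCD 4!polyC_natM 3!mulrDl -4!mulrA. Qed.

Definition ysum N (f : nat -> rat) : {poly rat} := \sum_(k < N) (f k)%:P * y ^+ k.

(** Everything telescopes except the end term, which is a multiple of ['X^N] because [y] is one of
    ['X]. *)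
Lemma ysum_shift N f : f 0%N = 0 ->
  ysum N f - y * ysum N (fun k => f k.+1) = - (f N)%:P * y ^+ N.
Proof.
move=> f0; rewrite /ysum; elim: N => [|N IH].
  by rewrite !big_ord0 f0 mulr0 polyC0 oppr0 mul0r addr0.
rewrite big_ord_recr [X in _ - y * X]big_ord_recr /= (mulrDr y) opprD addrACA IH.
by rewrite exprS; ring.
Qed.

(** Chain rule: ['D y / y = (1 - 54 'X) / q], with the denominator cleared. *)
Lemma euler_y k : q * 'D (y ^+ k) = (1 - 54 * 'X) * (k%:R * y ^+ k).
Proof.
elim: k => [|k IH]; first by rewrite expr0 derivE; ring.
rewrite exprS derivM.
have -> : (y)^`() = 1 - 54 * 'X.
  by rewrite derivM deriv_1subX derivX; ring.
have -> : q * ('X * ((1 - 54 * 'X) * y ^+ k + y * (y ^+ k)^`())) =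
  (1 - 54 * 'X) * y ^+ k * y + y * (q * 'D (y ^+ k)) by ring.
by rewrite IH -natr1; ring.
Qed.

Lemma euler_ysum N f :
  q * 'D (ysum N f) = (1 - 54 * 'X) * ysum N (fun k => k%:R * f k).
Proof.
rewrite /ysum raddf_sum /= !mulr_sumr; apply: eq_bigr => k _.
have -> : ((f k)%:P * y ^+ k)^`() = (f k)%:P * (y ^+ k)^`().
  by rewrite derivM derivC mul0r add0r.
have -> : q * ('X * ((f k)%:P * (y ^+ k)^`())) = (f k)%:P * (q * 'D (y ^+ k)) by ring.
by rewrite euler_y polyC_natM; ring.
Qed.

Definition wcoef k : rat := 6 * k%:R / k.+1%:R * (ccoef k)%:R.

(* With [U = \sum c_k y ^ k], this is the polynomial [W] that turns the equation
   of [U] into [sym_square_system]; it was found by solving the first line of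
   the system for [W].  At [k = 0] the truncated [k.-1] is harmless because
   [wcoef 0 = 0]. *)
Definition wpoly N : {poly rat} :=
  \sum_(k < N) (wcoef k)%:P * ('X ^+ k.+1 * q ^+ k.-1).

Lemma wpolyE N : q ^+ 2 * wpoly N = y * ysum N wcoef.
Proof.
rewrite /wpoly /ysum !mulr_sumr; apply: eq_bigr => -[[|k] kN] _ /=.
  by rewrite /wcoef !(mulr0, mul0r).
by rewrite !exprS exprMn; move: (q) => Q; ring.
Qed.

Lemma coprimeXn_q N : coprimep 'X^N q.
Proof.
apply: coprimep_expl; rewrite coprimep_sym -[X in coprimep _ X]subr0 -(polyC0 rat).
rewrite coprimep_XsubC.
by rewrite rootE horner_coef0 coefB coef_natM coefX coef1 mulr0 subr0 oner_eq0.
Qed.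

(** Multiplication by [q ^+ 2], which is prime to ['X^N], clears the denominators produced by the
    Euler operator. The first equation then becomes the recurrence of [ccoef] up to the end term of
    [ysum_shift]; the second becomes an identity, from [(k + 1) wcoef k = 6 k c_k]. *)
Lemma ccoef_system N :
  sym_square_system N (ysum N (fun k => (ccoef k)%:R)) (wpoly N).
Proof.
set B := ysum _ _; set W := wpoly N.
set B1 := ysum N (fun k => k%:R * (ccoef k)%:R).
set B2 := ysum N (fun k => k%:R * (k%:R * (ccoef k)%:R)).
have eB : q * 'D B = (1 - 54 * 'X) * B1 by apply: euler_ysum.
have eB1 : q * 'D B1 = (1 - 54 * 'X) * B2 by apply: euler_ysum.
have dq : q^`() = - 27. by apply: deriv_1subX.
(* Differentiate [eB]; the coefficient of [B2] comes from [(1 - 54 'X) ^+ 2 = 1 - 108 y]. *)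
have eB2 : q ^+ 2 * 'D ('D B) = (1 - 108 * y) * B2 - 27 * 'X * B1.
  have := congr1 (fun P : {poly rat} => P^`()) eB.
  rewrite [in LHS]derivM [in RHS]derivM dq.
  have -> : (1 - 54 * 'X : {poly rat})^`() = -54. by apply: deriv_1subX.
  move=> e.
  have -> : q ^+ 2 * 'D ('D B) = 'X * q * (- 27 * 'D B + q * ('D B)^`()) + 27 * 'X * (q * 'D B) by ring.
  rewrite e eB.
  have -> : 'X * q * (-54 * B1 + (1 - 54 * 'X) * B1^`())
      = -54 * 'X * q * B1 + (1 - 54 * 'X) * (q * 'D B1) by ring.
  by rewrite eB1; ring.
have eW : q ^+ 2 * W = y * ysum N wcoef by apply: wpolyE.
have cq2 : coprimep 'X^N (q ^+ 2) by apply/coprimep_expr/coprimeXn_q.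
split; rewrite -(Gauss_dvdpr _ cq2).
- have -> : q ^+ 2 * (q * ('D ('D B) - 2 * W) - 27 * 'X * 'D B - 12 * 'X * B) =
     q * (q ^+ 2 * 'D ('D B) - 2 * (q ^+ 2 * W) - 27 * 'X * (q * 'D B) - 12 * y * B) by ring.
  rewrite eB2 eW eB; apply: dvdp_mull.
  have -> : (1 - 108 * y) * B2 - 27 * 'X * B1 - 2 * (y * ysum N wcoef)
     - 27 * 'X * ((1 - 54 * 'X) * B1) - 12 * y * B
     = B2 - y * (108 * B2 + 54 * B1 + 12 * B + 2 * ysum N wcoef) by ring.
  (* Dividing [6 (2 k + 1) (3 k + 1) (3 k + 2)] by [k + 1] gives [108 k^2 + 54 k + 12] with
     remainder [12 k]; the term [2 * wcoef k] accounts for this remainder in [f k.+1]. *)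
  pose f k : rat := k%:R * (k%:R * (ccoef k)%:R).
  have -> : 108 * B2 + 54 * B1 + 12 * B + 2 * ysum N wcoef = ysum N (fun k => f k.+1).
    rewrite /B2 /B1 /B /ysum !mulr_sumr -!big_split /=; apply: eq_bigr => k _.
    have -> : f k.+1 = 108 * (k%:R * (k%:R * (ccoef k)%:R)) + 54 * (k%:R * (ccoef k)%:R)
       + 12 * (ccoef k)%:R + 2 * wcoef k.
      rewrite /f /wcoef.
      have k0 : 0 <= k%:R :> rat by [].
      have k1 : k.+1%:R != 0 :> rat by rewrite pnatr_eq0.
      apply: (mulfI k1).
      transitivity ((k%:R + 1) ^+ 3 * (ccoef k.+1)%:R : rat); first by rewrite -natr1; ring.
      rewrite ccoefSr -natr1; field.
      by apply/eqP; lra.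
    by rewrite polyC_comb.
  apply/dvdXnP.
  have -> : B2 - y * ysum N (fun k => f k.+1) = - (f N)%:P * y ^+ N.
    by apply: (@ysum_shift N f); rewrite /f mul0r.
  by apply/dvdXnP; rewrite exprMn; apply/dvdp_mull/dvdp_mulr.
set V := ysum N wcoef in eW.
have eV : q * 'D V = (1 - 54 * 'X) * ysum N (fun k => k%:R * wcoef k) by apply: euler_ysum.
have e1 : V + ysum N (fun k => k%:R * wcoef k) = 6 * B1.
  rewrite /V /B1 /ysum -big_split mulr_sumr /=; apply: eq_bigr => k _.
  rewrite -mulrDl -polyCD [in RHS]mulrA -polyC_natM; congr (_%:P * _).
  have k0 : 0 <= k%:R :> rat by [].
  by rewrite /wcoef -natr1; field; apply/eqP; lra.
have dW : q ^+ 2 * 'D W = 54 * 'X * q * W + 'X * (1 - 54 * 'X) * V + y * 'D V.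
  have := congr1 (fun P : {poly rat} => P^`()) eW.
  rewrite /= expr2 [in LHS]derivM [in LHS]derivM [in RHS]derivM [in RHS]derivM dq derivX => e.
  have -> : q ^+ 2 * 'D W = 'X * ((- 27 * q + q * - 27) * W + q * q * W^`()) + 54 * 'X * q * W by ring.
  by rewrite e; ring.
have -> : q ^+ 2 * (q * 'D W - 54 * 'X * W - 6 * 'X * 'D B) =
   q * (q ^+ 2 * 'D W) - 54 * 'X * (q ^+ 2 * W) - 6 * 'X * q * (q * 'D B) by ring.
rewrite dW eB.
have -> : q * (54 * 'X * q * W + 'X * (1 - 54 * 'X) * V + y * 'D V)
    - 54 * 'X * (q ^+ 2 * W) - 6 * 'X * q * ((1 - 54 * 'X) * B1)
   = 'X * q * ((1 - 54 * 'X) * (V - 6 * B1) + q * 'D V) by ring.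
rewrite eV -e1.
rewrite (_ : _ * _ + _ = 0) ?mulr0 ?dvdp0 //; ring.
Qed.

(** Both sides come from solutions of [sym_square_system] with constant term 1, so their difference
    falls under [sym_square_system_eq0]. *)
Lemma clausen_coef N m : (m < N)%N ->
  (apoly N ^+ 2)`_m = (ysum N (fun k => (ccoef k)%:R))`_m.
Proof.
move=> mN; apply/eqP; rewrite -subr_eq0 -coefB; apply/eqP.
apply: sym_square_system_eq0 mN; last first.
  by apply: sym_square_systemB; [apply: apoly_system | apply: ccoef_system].
case: N => [|N].
  by rewrite /apoly /ysum big_ord0 poly_def big_ord0 expr2 mul0r subrr coef0.
rewrite coefB expr2 coef0M coef_poly /ysum coef_sum big_ord_recl big1.
  by rewrite /= coefCM expr0 coef1 mulr1 addr0 subrr.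
by move=> k _; rewrite coefCM exprS -mulrA coefXM mulr0.
Qed.

End Clausen.

(** * Cubic Jacobi sums *)

Definition jacobi (F : finFieldType) (R : comNzRingType) (c : F -> R) : R :=
  \sum_t c t * c (1 - t).

Section JacobiNorm.

Variables (F : finFieldType) (R : comNzRingType) (c : F -> R).
Hypothesis c0 : c 0 = 0.
Hypothesis cM : {morph c : x y / x * y}.
Hypothesis c3 : forall x, x != 0 -> c x ^+ 3 = 1.
Hypothesis sum_c : \sum_x c x = 0.
Hypothesis sum_c2 : \sum_x c x ^+ 2 = 0.

Lemma cubic_char1 : c 1 = 1.
Proof.
have h := c3 (oner_neq0 F).
by move: (h); rewrite exprS expr2 -!cM !mul1r => ->.
Qed.

Lemma cubic_charV x : c x^-1 = c x ^+ 2.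
Proof.
have [->|x0] := eqVneq x 0; first by rewrite invr0 c0 expr0n.
have := cM x^-1 x; rewrite mulVf // cubic_char1 => h.
by rewrite -[LHS]mulr1 -(c3 x0) exprS mulrA -h mul1r.
Qed.

(* [u |-> (1 - u s) / (1 - u)] maps [F \ {0, 1}] onto [F \ {1, s}]. *)
Lemma sum_c_moebius s : s != 0 -> s != 1 ->
  \sum_(u | (u != 0) && (u != 1)) c ((1 - u * s) / (1 - u)) = - 1 - c s.
Proof.
move=> s0 s1.
have -> : - 1 - c s = \sum_(v | (v != 1) && (v != s)) c v.
  have : \sum_v c v = 0 := sum_c.
  rewrite (bigD1 1) //= (bigD1 s) //= cubic_char1 => h.
  move: (\sum_(_ | _) _) h => S h.
  by transitivity (S - (1 + (c s + S))); [ring | rewrite h subr0].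
rewrite [RHS](reindex_onto (fun u => (1 - u * s) / (1 - u))
                           (fun v => (v - 1) / (v - s))) /=; last first.
  move=> v /andP[v1 vs].
  have h : v - s != 0 by rewrite subr_eq0.
  have h' : 1 - s != 0 by rewrite subr_eq0 eq_sym.
  field; rewrite h /=.
  rewrite (_ : v - s - (v - 1) = 1 - s) ?h' //; ring.
apply: eq_bigl => u.
have [->|u1] := eqVneq u 1.
  rewrite andbF subrr invr0 mulr0 !sub0r mulN1r invrN opprK.
  by rewrite invr_eq1 (negPf s1) andbF.
have h1 : 1 - u != 0 by rewrite subr_eq0 eq_sym.
have hs : 1 - s != 0 by rewrite subr_eq0 eq_sym.
have e1 : ((1 - u * s) / (1 - u) == 1) = (u == 0).
  rewrite -subr_eq0 (_ : _ - 1 = u * (1 - s) / (1 - u)); last by field.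
  by rewrite !mulf_eq0 invr_eq0 (negPf h1) (negPf hs) !orbF.
have e2 : ((1 - u * s) / (1 - u) == s) = false.
  rewrite -subr_eq0 (_ : _ - s = (1 - s) / (1 - u)); last by field.
  by rewrite !mulf_eq0 invr_eq0 (negPf h1) (negPf hs) !orbF.
rewrite e1 e2 !andbT; have [//|u0] := eqVneq u 0.
rewrite /=; apply/esym/eqP; field.
rewrite h1 /=.
by rewrite (_ : 1 - u * s + - s * (1 - u) = 1 - s) //; ring.
Qed.

(** On nonzero arguments [c ^+ 2] is the inverse character. Substituting [t = u s] in the first sum
    and then summing over [u] leaves [sum_c_moebius] for each [s] other than 0 and 1, while [s = 1]
    contributes [#|F| - 2]. *)
Lemma jacobi_norm : jacobi c * jacobi (fun x => c x ^+ 2) = #|F|%:R.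
Proof.
rewrite /jacobi mulr_sumr.
rewrite (bigID (fun u => (u != 0) && (u != 1))) /= [X in _ + X]big1 ?addr0; last first.
  move=> u; rewrite negb_and !negbK => /orP[] /eqP ->.
    by rewrite c0 expr0n mul0r mulr0.
  by rewrite subrr c0 expr0n /= !mulr0.
have e u : (u != 0) && (u != 1) ->
   (\sum_t c t * c (1 - t)) * (c u ^+ 2 * c (1 - u) ^+ 2)
   = \sum_s c s * c ((1 - u * s) / (1 - u)).
  move=> /andP[u0 u1].
  rewrite (reindex_onto (fun s => u * s) (fun t => u^-1 * t)) /=; last first.
    by move=> t _; rewrite mulrA divff ?mul1r.
  rewrite (eq_bigl xpredT); last by move=> s; rewrite mulrA mulVf // mul1r eqxx.
  rewrite mulr_suml; apply: eq_bigr => s _.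
  rewrite !cM cubic_charV.
  transitivity (c u ^+ 3 * (c s * (c (1 - u * s) * c (1 - u) ^+ 2))); first by ring.
  by rewrite c3 // mul1r.
rewrite (eq_bigr _ e) exchange_big /=.
rewrite (bigD1 1) //= [X in _ + X](bigD1 0) /=; last by rewrite eq_sym oner_neq0.
rewrite [X in _ + (X + _)]big1; last by move=> u _; rewrite c0 mul0r.
rewrite add0r [X in _ + X](eq_bigr (fun s => - (c s + c s ^+ 2))); last first.
  move=> s /andP[s1 s0] /=; transitivity (c s * (- 1 - c s)); last by ring.
  by rewrite -(sum_c_moebius s0 s1) mulr_sumr.
rewrite sumrN big_split /=.
have -> : \sum_(i | (i != 1) && (i != 0)) c i = - 1.
  have : \sum_v c v = 0 := sum_c.
  rewrite (bigD1 1) //= (bigD1 0) /=; last by rewrite eq_sym oner_neq0.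
  rewrite cubic_char1 ?c0 ?expr1n ?expr0n /= ?expr1n; move: (\sum_(_ | _) _) => S h.
  by transitivity (1 + (0 + S) - 1); [ring | rewrite h sub0r].
have -> : \sum_(i | (i != 1) && (i != 0)) c i ^+ 2 = - 1.
  have : \sum_v c v ^+ 2 = 0 := sum_c2.
  rewrite (bigD1 1) //= (bigD1 0) /=; last by rewrite eq_sym oner_neq0.
  rewrite cubic_char1 ?c0 ?expr1n ?expr0n /= ?expr1n; move: (\sum_(_ | _) _) => S h.
  by transitivity (1 + (0 + S) - 1); [ring | rewrite h sub0r].
rewrite (eq_bigr (fun=> 1)); last first.
  move=> u /andP[u0 u1]; rewrite cubic_char1 mul1r mulr1 divff ?cubic_char1 //.
  by rewrite subr_eq0 eq_sym.
have -> : #|F|%:R = \sum_(u : F) (1 : R) by rewrite sumr_const.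
by rewrite [in RHS](bigD1 1) //= [in RHS](bigD1 0) /= 1?eq_sym ?oner_neq0 //
  (eq_bigl (fun u : F => (u != 1) && (u != 0))) => [|u]; [ring | rewrite andbC].
Qed.

End JacobiNorm.

(** * Cubic residue classes and cyclotomic numbers of order 3 *)

Section CubicClass.

Variables (F : finFieldType) (n : nat) (t0 : F).
Hypothesis cardF : #|F| = (3 * n).+1.
Hypothesis t0_neq0 : t0 != 0.
Local Notation z := (t0 ^+ n).
Hypothesis z1 : z != 1.

Lemma expf_3n (t : F) : t != 0 -> t ^+ (3 * n) = 1.
Proof.
move=> tn0; apply: (mulfI tn0); rewrite mulr1 -exprS -cardF; exact: expf_card.
Qed.

Lemma cubic_prim_root : 3.-primitive_root z.
Proof.
have z3 : z ^+ 3 = 1 by rewrite -exprM mulnC expf_3n.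
have [m zm] := prim_order_exists (isT : (0 < 3)%N) z3.
case: m zm => [|[|[|[|m]]]] zm m3 //.
by have := prim_expr_order zm; rewrite expr1 => /eqP; rewrite (negPf z1).
Qed.

(** For nonzero [t], the exponent [m < 3] with [t ^+ n = z ^+ m]. Keeping it a natural number lets
    [cubic_char] take values in any ring with a root of [1 + w + w ^+ 2], both [algC] and
    [zmod_sqr p] below. *)
Definition cubic_class (t : F) : nat :=
  if t ^+ n == 1 then 0%N else if t ^+ n == z then 1%N else 2%N.

Lemma cubic_class_lt t : (cubic_class t < 3)%N.
Proof. by rewrite /cubic_class; do 2?case: ifP. Qed.

Lemma cubic_classP t : t != 0 -> z ^+ cubic_class t = t ^+ n.
Proof.
move=> tn0; have t3 : (t ^+ n) ^+ 3 = 1 by rewrite -exprM mulnC expf_3n.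
have [[i i3] /= e] := prim_rootP cubic_prim_root t3.
rewrite /cubic_class; case: eqP => [->|h1] //; case: eqP => [->|h2] //.
by case: i i3 e => [|[|[|i]]] // _ e; rewrite e.
Qed.

Lemma cubic_classE t m : t != 0 -> (m < 3)%N -> t ^+ n = z ^+ m ->
  cubic_class t = m.
Proof.
move=> tn0 m3; rewrite -cubic_classP // => /eqP.
by rewrite (eq_prim_root_expr cubic_prim_root) !modn_small ?cubic_class_lt // => /eqP.
Qed.

Lemma cubic_classM s t : s != 0 -> t != 0 ->
  cubic_class (s * t) = ((cubic_class s + cubic_class t) %% 3)%N.
Proof.
move=> s0 t1; apply: cubic_classE; rewrite ?mulf_neq0 ?ltn_mod //.
by rewrite (prim_expr_mod cubic_prim_root) exprD !cubic_classP // exprMn.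
Qed.

Definition cubic_char (R : pzRingType) (w : R) (t : F) : R :=
  if t == 0 then 0 else w ^+ cubic_class t.

Definition cubic_count (i j : nat) : nat :=
  #|[pred t : F | [&& t != 0, t != 1, cubic_class t == i & cubic_class (1 - t) == j]]|.

Lemma cubic_classN t : cubic_class (- t) = cubic_class t.
Proof.
have [->|tn0] := eqVneq t 0; first by rewrite oppr0.
apply: cubic_classE; rewrite ?oppr_eq0 ?cubic_class_lt //.
rewrite cubic_classP // -mulN1r exprMn.
have -> : (-1 : F) ^+ n = 1; last by rewrite mul1r.
have h : ((-1 : F) ^+ n) ^+ 3 = 1 by rewrite -exprM mulnC expf_3n // oppr_eq0 oner_eq0.
rewrite -[LHS]mulr1 -[X in _ * X = _](_ : ((-1 : F) ^+ n) ^+ 2 = 1).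
  by rewrite -exprS h.
by rewrite -exprM mulnC exprM sqrrN expr1n expr1n.
Qed.

Lemma cubic_classV t : t != 0 -> cubic_class t^-1 = ((2 * cubic_class t) %% 3)%N.
Proof.
move=> tn0; have := cubic_classM (invr_neq0 tn0) tn0.
rewrite mulVf // {1}/cubic_class expr1n eqxx.
have := cubic_class_lt t; have := cubic_class_lt t^-1.
by case: (cubic_class t) => [|[|[|]]] //; case: (cubic_class t^-1) => [|[|[|]]].
Qed.

Lemma cubic_count_sym i j : cubic_count i j = cubic_count j i.
Proof.
rewrite /cubic_count -(card_image (f := fun t : F => 1 - t)); last first.
  by move=> x y /addrI /oppr_inj.
apply: eq_card => t; rewrite !inE.
apply/imageP/idP => [[u]|].
  rewrite !inE => /and4P[u0 u1 ui uj] ->.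
  rewrite subr_eq0 [1 == u]eq_sym u1 /= uj opprB addrCA subrr addr0 ui andbT.
  by rewrite andbT -subr_eq0 addrAC subrr sub0r oppr_eq0.
move=> /and4P[t0' t1 ti tj]; exists (1 - t); last by rewrite opprB addrCA subrr addr0.
rewrite !inE subr_eq0 [1 == t]eq_sym t1 /= tj opprB addrCA subrr addr0 ti andbT.
by rewrite andbT -subr_eq0 addrAC subrr sub0r oppr_eq0.
Qed.

(** Under [t -> t^-1], [1 - t] becomes [- (1 - t) / t]. Inversion negates classes, written as
    [2 * i] modulo 3, and a sign does not change them. *)
Lemma cubic_count_inv i j : (i < 3)%N -> (j < 3)%N ->
  cubic_count i j = cubic_count ((2 * i) %% 3)%N ((j + 2 * i) %% 3)%N.
Proof.
move=> i3 j3.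
have inv_class t : t != 0 -> t != 1 ->
    cubic_class (1 - t^-1) = ((cubic_class (1 - t)%R + 2 * cubic_class t) %% 3)%N.
  move=> tn0 t1; have -> : 1 - t^-1 = - (1 - t) * t^-1 by field.
  have tn1 : 1 - t != 0 by rewrite subr_eq0 eq_sym.
  rewrite cubic_classM ?invr_neq0 ?oppr_eq0 //.
  by rewrite cubic_classN cubic_classV // modnDmr.
rewrite /cubic_count -(card_image (f := fun t : F => t^-1)); last exact: invr_inj.
apply: eq_card => t; rewrite !inE.
apply/imageP/idP => [[u]|].
  rewrite !inE => /and4P[u0 u1 /eqP <- /eqP <-] ->.
  by rewrite invr_eq0 u0 invr_eq1 u1 inv_class // cubic_classV // !eqxx.
move=> /and4P[t0' t1 ti tj]; exists t^-1; last by rewrite invrK.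
rewrite !inE invr_eq0 t0' invr_eq1 t1 inv_class // cubic_classV //.
move: i3 j3 ti tj (cubic_class_lt t) (cubic_class_lt (1 - t)).
by case: i => [|[|[|]]] //; case: j => [|[|[|]]] //;
  case: (cubic_class t) => [|[|[|]]] //; case: (cubic_class (1 - t)) => [|[|[|]]].
Qed.

Section Root.

Variables (R : comNzRingType) (w : R).
Hypothesis w_root : 1 + w + w ^+ 2 = 0.

Lemma cubic_root3 : w ^+ 3 = 1.
Proof.
apply/eqP; rewrite -subr_eq0; apply/eqP.
transitivity ((w - 1) * (1 + w + w ^+ 2)); first by ring.
by rewrite w_root mulr0.
Qed.

Lemma cubic_rootX2 : 1 + w ^+ 2 + (w ^+ 2) ^+ 2 = 0.
Proof.
transitivity (1 + w + w ^+ 2 + w * (w ^+ 3 - 1)); first by ring.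
by rewrite w_root cubic_root3 subrr mulr0 addr0.
Qed.

Lemma expr_cubic_mod m : w ^+ (m %% 3)%N = w ^+ m.
Proof. by rewrite [in RHS](divn_eq m 3) exprD mulnC exprM cubic_root3 expr1n mul1r. Qed.

Lemma cubic_charM : {morph cubic_char w : s t / s * t}.
Proof.
move=> s t; rewrite /cubic_char mulf_eq0.
case: eqVneq => [->|s0]; first by rewrite /= mul0r.
case: eqVneq => [->|t1]; first by rewrite /= ?orbT mulr0.
by rewrite /= cubic_classM // expr_cubic_mod exprD.
Qed.

Lemma cubic_char3 t : t != 0 -> cubic_char w t ^+ 3 = 1.
Proof.
by move=> tn0; rewrite /cubic_char (negPf tn0) -exprM mulnC exprM cubic_root3 expr1n.
Qed.

Lemma cubic_char0 : cubic_char w 0 = 0.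
Proof. by rewrite /cubic_char eqxx. Qed.

Lemma cubic_charX2 t : cubic_char (w ^+ 2) t = cubic_char w t ^+ 2.
Proof. by rewrite /cubic_char; case: eqP; rewrite ?expr0n // -!exprM mulnC. Qed.

Lemma cubic_char_t0 : cubic_char w t0 = w.
Proof.
rewrite /cubic_char (negPf t0_neq0) (@cubic_classE t0 1%N) //; exact: expr1.
Qed.

End Root.

(** Multiplication by [t0] permutes the field and multiplies the sum [S] by [w], so [(1 - w) S = 0];
    and [1 - w] divides 3, as [(2 + w) (1 - w) = 3 - (1 + w + w ^+ 2)]. *)
Lemma sum_cubic_char (R : comUnitRingType) (w : R) :
  1 + w + w ^+ 2 = 0 -> (3 : R) \is a GRing.unit -> \sum_t cubic_char w t = 0.
Proof.
move=> w_root u3; set S := \sum_t _.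
have e : w * S = S.
  rewrite /S [in RHS](reindex_onto (fun s => t0 * s) (fun s => t0^-1 * s)) /=; last first.
    by move=> t _; rewrite mulrA divff ?mul1r.
  rewrite [in RHS](eq_bigl xpredT); last by move=> s; rewrite mulrA mulVf // mul1r eqxx.
  rewrite mulr_sumr; apply: eq_bigr => s _.
  by rewrite (cubic_charM w_root) cubic_char_t0.
apply: (mulrI u3); rewrite mulr0.
transitivity ((2 + w) * (S - w * S) + S * (1 + w + w ^+ 2)); first by ring.
by rewrite e w_root subrr !mulr0 addr0.
Qed.

Lemma jacobi_cubic_norm (R : comUnitRingType) (w : R) :
  1 + w + w ^+ 2 = 0 -> (3 : R) \is a GRing.unit ->
  jacobi (cubic_char w) * jacobi (cubic_char (w ^+ 2)) = #|F|%:R.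
Proof.
move=> w_root u3.
have -> : jacobi (cubic_char (w ^+ 2)) = jacobi (fun t => cubic_char w t ^+ 2).
  by apply: eq_bigr => t _; rewrite !cubic_charX2.
apply: jacobi_norm.
- exact: cubic_char0.
- exact: cubic_charM.
- exact: cubic_char3.
- exact: sum_cubic_char.
rewrite -[RHS](sum_cubic_char (cubic_rootX2 w_root) u3).
by apply: eq_bigr => t _; rewrite cubic_charX2.
Qed.

(* The substitutions [t -> 1 - t] and [t -> 1 / t] give
   [N_01 = N_10 = N_22] and [N_02 = N_20 = N_11]; these factors 3 are the source of
   the coefficient 27 in [4 p = A ^ 2 + 27 B ^ 2]. *)
Lemma jacobi_cubicE (R : comNzRingType) (w : R) : 1 + w + w ^+ 2 = 0 ->
  jacobi (cubic_char w) =
    (cubic_count 0 0 + cubic_count 1 2 + cubic_count 2 1)%:R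
    + 3 * (cubic_count 0 1)%:R * w + 3 * (cubic_count 0 2)%:R * w ^+ 2.
Proof.
move=> w_root.
pose T (t : F) i j : R :=
  ([&& t != 0, t != 1, cubic_class t == i & cubic_class (1 - t) == j])%:R.
have Tsum i j : \sum_t T t i j = (cubic_count i j)%:R.
  by rewrite /T -natr_sum /cubic_count -sum1_card [in RHS]big_mkcond /=;
     congr (_%:R); apply: eq_bigr => t _; rewrite !inE; case: ifP => ->.
have e t : cubic_char w t * cubic_char w (1 - t) =
    T t 0 0 + T t 1 2 + T t 2 1 + (T t 0 1 + T t 1 0 + T t 2 2) * w
    + (T t 0 2 + T t 2 0 + T t 1 1) * w ^+ 2.
  rewrite /cubic_char /T.
  have [->|tn0] /= := eqVneq t 0; first by rewrite !mul0r; ring.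
  rewrite subr_eq0 [1 == t]eq_sym.
  have [->|t1] /= := eqVneq t 1; first by rewrite !mulr0; ring.
  have w3 := cubic_root3 w_root.
  move: (cubic_class_lt t) (cubic_class_lt (1 - t)).
  case: (cubic_class t) => [|[|[|//]]];
    case: (cubic_class (1 - t)) => [|[|[|//]]] _ _ /=; rewrite ?expr0; try ring.
  - by rewrite -exprD w3; ring.
  - by rewrite -exprD w3; ring.
  by rewrite -exprD (exprS _ 3) w3; ring.
rewrite /jacobi (eq_bigr _ (fun t _ => e t)) !big_split /= -!mulr_suml !big_split /= !Tsum.
have -> : cubic_count 1 0 = cubic_count 0 1 by apply: cubic_count_sym.
have -> : cubic_count 2 0 = cubic_count 0 2 by apply: cubic_count_sym.
have -> : cubic_count 2 2 = cubic_count 0 1.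
  by rewrite (cubic_count_sym 0) (@cubic_count_inv 1 0).
have -> : cubic_count 1 1 = cubic_count 0 2.
  by rewrite (cubic_count_sym 0) (@cubic_count_inv 2 0).
by rewrite !natrD; ring.
Qed.

End CubicClass.

(** With [J = a + 3 b w + 3 c w ^+ 2], the trace of [J] is [A] and four times its norm is
    [A ^+ 2 + 27 B ^+ 2]. The norm is computed in [algC], where integers embed; the trace formula is
    stated over every [R] because it is later applied modulo [p ^ 2]. *)
Lemma cubic_jacobi_form (F : finFieldType) (n : nat) (t0 : F) :
  #|F| = (3 * n).+1 -> t0 != 0 -> t0 ^+ n != 1 ->
  exists A B : int,
    4 * #|F|%:Z = A ^+ 2 + 27 * B ^+ 2 /\
    forall (R : comNzRingType) (w : R), 1 + w + w ^+ 2 = 0 ->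
      jacobi (cubic_char n t0 w) + jacobi (cubic_char n t0 (w ^+ 2)) = A%:~R.
Proof.
move=> cardF t00 z1.
set a := (cubic_count n t0 0 0 + cubic_count n t0 1 2 + cubic_count n t0 2 1)%N.
set b := cubic_count n t0 0 1; set c := cubic_count n t0 0 2.
pose A : int := 2 * a%:Z - 3 * b%:Z - 3 * c%:Z; pose B : int := b%:Z - c%:Z.
have JE (R : comNzRingType) (w : R) : 1 + w + w ^+ 2 = 0 ->
    jacobi (cubic_char n t0 w) = a%:R + 3 * b%:R * w + 3 * c%:R * w ^+ 2.
  exact: jacobi_cubicE.
have AE (R : comNzRingType) : A%:~R = 2 * a%:R - 3 * b%:R - 3 * c%:R :> R by rewrite /A; ring.
exists A, B; split; last first.
  move=> R w w_root; rewrite !JE //; last exact: cubic_rootX2.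
  rewrite AE.
  transitivity (2 * a%:R + 3 * b%:R * (1 + w + w ^+ 2 - 1)
    + 3 * c%:R * (1 + w + w ^+ 2 + w * (w ^+ 3 - 1) - 1) : R); first by ring.
  by rewrite w_root cubic_root3 //; ring.
have [w w_root] : exists w : algC, 1 + w + w ^+ 2 = 0.
  have [w w_prim] := C_prim_root_exists (isT : (0 < 3)%N).
  exists w; have := prim_expr_order w_prim => w3.
  have w1 : w - 1 != 0.
    by rewrite subr_eq0 -(expr0 w) -[X in X == _]expr1 (eq_prim_root_expr w_prim).
  apply: (mulfI w1); rewrite mulr0.
  by transitivity (w ^+ 3 - 1); [ring | rewrite w3 subrr].
have := jacobi_cubic_norm cardF t00 z1 w_root.
rewrite unitfE pnatr_eq0 => /(_ isT).
rewrite !JE //; last exact: cubic_rootX2.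
have w3 := cubic_root3 w_root.
move=> e; apply: (intr_inj (R := algC)).
transitivity (4 * #|F|%:R : algC); first by ring.
transitivity (A%:~R ^+ 2 + 27 * B%:~R ^+ 2 : algC); last by ring.
have -> : B%:~R = b%:R - c%:R :> algC by rewrite /B; ring.
rewrite AE -e.
move: (a%:R) (b%:R) (c%:R) => ra rb rc; apply/eqP; rewrite -subr_eq0; apply/eqP.
transitivity
  (4 * ((1 + w + w ^+ 2) * (3 * ra * rb + 3 * ra * rc + 9 * rb * rc)
  + (w ^+ 3 - 1) * (3 * ra * rc * w + 9 * rb ^+ 2 + 9 * rb * rc * (w ^+ 2 + w)
                    + 9 * rc ^+ 2 * (w ^+ 3 + 1)))); first by ring.
by rewrite w_root w3 subrr !mul0r addr0 mulr0.
Qed.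

(** * Reduction modulo the square of a prime *)

Lemma prime_dvd_fact p k : prime p -> (p %| k`!)%N = (p <= k)%N.
Proof.
move=> pp; elim: k => [|k IH]; first by rewrite dvdn1 leqNgt prime_gt0 // gtn_eqF // prime_gt1.
rewrite factS Euclid_dvdM // IH; apply/orP/idP => [[/dvdn_leq->//|/leqW//]|].
by rewrite leq_eqVlt => /orP[/eqP->|]; [left|right].
Qed.

Lemma fermat_unit p k : prime p -> ~~ (p %| k)%N -> (p %| k ^ p.-1 - 1)%N.
Proof.
move=> pp pk; have k0 : (0 < k)%N by case: k pk; rewrite ?dvdn0.
have := fermat_little k pp; rewrite -{1}(prednK (prime_gt0 pp)) expnS => /eqP.
rewrite eqn_mod_dvd ?leq_pmulr ?expn_gt0 ?k0 // -{3}[k]muln1 -mulnBr.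
by rewrite Gauss_dvdr // prime_coprime.
Qed.

(* A named structure, so that [0] and [1] are inferred from the ring and not from
   the underlying ordinal type. *)
Definition zmod_sqr (p : nat) : comUnitRingType := 'Z_(p ^ 2).

Section ModSquare.

Variable p : nat.
Hypothesis p_prime : prime p.
Local Notation R := (zmod_sqr p).

Lemma prime_sqr_gt1 : (1 < p ^ 2)%N.
Proof. by rewrite -(exp1n 2) ltn_exp2r // prime_gt1. Qed.

Lemma natR_eq0 n : (n%:R == 0 :> R) = (p ^ 2 %| n)%N.
Proof.
rewrite -[LHS]/(n%:R == 0 :> 'Z_(p ^ 2)).
by rewrite -val_eqE /= val_Zp_nat ?prime_sqr_gt1.
Qed.

Lemma intR_eq0 (n : int) : (n%:~R == 0 :> R) = (p ^ 2 %| `|n|)%N.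
Proof.
by rewrite -natR_eq0; case: n => k //; rewrite NegzE mulrNz oppr_eq0 abszN.
Qed.

Lemma natR_unit n : ((n%:R : R) \is a GRing.unit) = ~~ (p %| n)%N.
Proof.
rewrite -[LHS]/((n%:R : 'Z_(p ^ 2)) \is a GRing.unit).
by rewrite unitZpE ?prime_sqr_gt1 // coprime_pexpl // prime_coprime.
Qed.

Lemma natR_surj (x : R) : exists n : nat, x = n%:R.
Proof. by exists (x : 'Z_(p ^ 2)); rewrite -[LHS](@natr_Zp (Zp_trunc (p ^ 2))). Qed.

Lemma intR_unit (n : int) : ((n%:~R : R) \is a GRing.unit) = ~~ (p %| `|n|)%N.
Proof.
by rewrite -natR_unit; case: n => k //; rewrite NegzE mulrNz unitrN abszN.
Qed.

Lemma sqr_pR : p%:R * p%:R = 0 :> R.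
Proof. by apply/eqP; rewrite -natrM natR_eq0 mulnn. Qed.

(* The maximal ideal [p R]; its square is zero. *)
Definition pmult (x : R) : Prop := exists c, x = p%:R * c.

Lemma pmult_or_unit x : pmult x \/ x \is a GRing.unit.
Proof.
have [n ->] := natR_surj x; rewrite natR_unit; case: (boolP (p %| n)%N) => [/dvdnP[q ->]|]; last by right.
by left; exists q%:R; rewrite natrM mulrC.
Qed.

Lemma pmult_nunit x : pmult x -> x \isn't a GRing.unit.
Proof.
move=> [c ->]; rewrite unitrM negb_and.
by rewrite natR_unit dvdnn.
Qed.

Lemma pmult_nat n : pmult n%:R -> (p %| n)%N.
Proof. by move/pmult_nunit; rewrite natR_unit negbK. Qed.

Lemma nat_pmult n : (p %| n)%N -> pmult n%:R.
Proof. by move=> /dvdnP[q ->]; exists q%:R; rewrite natrM mulrC. Qed.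

Lemma pmult0 : pmult 0. Proof. by exists 0; rewrite mulr0. Qed.
Lemma pmultD x y : pmult x -> pmult y -> pmult (x + y).
Proof. by move=> [c ->] [d ->]; exists (c + d); rewrite mulrDr. Qed.
Lemma pmultN x : pmult x -> pmult (- x).
Proof. by move=> [c ->]; exists (- c); rewrite mulrN. Qed.
Lemma pmultB x y : pmult x -> pmult y -> pmult (x - y).
Proof. by move=> hx hy; apply: pmultD => //; apply: pmultN. Qed.
Lemma pmultMl x y : pmult y -> pmult (x * y).
Proof. by move=> [c ->]; exists (x * c); rewrite mulrCA. Qed.
Lemma pmultMr x y : pmult x -> pmult (x * y).
Proof. by move=> h; rewrite mulrC; apply: pmultMl. Qed.
Lemma pmultM0 x y : pmult x -> pmult y -> x * y = 0.
Proof. by move=> [c ->] [d ->]; rewrite mulrACA sqr_pR mul0r. Qed.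
Lemma pmult_sqr x : pmult x -> x ^+ 2 = 0.
Proof. by move=> h; rewrite expr2 pmultM0. Qed.
Lemma pmult_p x : pmult (p%:R * x). Proof. by exists x. Qed.
Lemma pmult_prodB (I : Type) (r : seq I) (f g : I -> R) :
  (forall i, pmult (f i - g i)) ->
  pmult (\prod_(i <- r) f i - \prod_(i <- r) g i).
Proof.
move=> h; elim: r => [|i r IH]; first by rewrite !big_nil subrr; apply: pmult0.
rewrite !big_cons.
rewrite (_ : _ - _ = f i * (\prod_(j <- r) f j - \prod_(j <- r) g j)
   + (f i - g i) * \prod_(j <- r) g j); last by ring.
by apply: pmultD; [apply: pmultMl | apply: pmultMr].
Qed.

Lemma unit_pmult x y : x \is a GRing.unit -> pmult y -> x + y \is a GRing.unit.
Proof.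
move=> ux hy; have : (x + y) * (x - y) \is a GRing.unit.
  by rewrite mulrC -subr_sqr (pmult_sqr hy) subr0 unitrX.
by rewrite unitrM => /andP[].
Qed.

Lemma pmult_fermat x : x \is a GRing.unit -> pmult (x ^+ p.-1 - 1).
Proof.
have [k ->] := natR_surj x; rewrite natR_unit => pk.
have k0 : (0 < k)%N by case: k pk; rewrite ?dvdn0.
rewrite -natrX -(natrB _ (n := 1)) ?expn_gt0 ?k0 //.
by apply/nat_pmult/fermat_unit.
Qed.

Lemma exprD_pmult x d m : pmult d -> (x + d) ^+ m = x ^+ m + m%:R * x ^+ m.-1 * d.
Proof.
move=> hd; case: m => [|m]; first by rewrite !expr0 mul0r mul0r addr0.
elim: m => [|m IH]; first by rewrite !expr1 expr0 /=; ring.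
rewrite exprS IH /=.
transitivity (x ^+ m.+2 + m.+2%:R * x ^+ m.+1 * d + m.+1%:R * x ^+ m * d ^+ 2).
  by rewrite !exprS -![m.+2%:R]natr1; ring.
by rewrite pmult_sqr // mulr0 addr0.
Qed.

(** The linear term of the expansion carries a factor [p] and a multiple of [p], hence vanishes.
    Thus [p]-th powers depend only on residues modulo [p]. *)
Lemma pmult_frobenius x y : pmult (x - y) -> x ^+ p = y ^+ p.
Proof.
move=> h; have -> : x = y + (x - y) by ring.
by rewrite exprD_pmult // (pmultM0 (pmult_p _) h) addr0.
Qed.

(* [r] lies in Z_(p) and [x] is its image in Z_(p) / p ^ 2. *)
Definition red (r : rat) (x : R) : Prop :=
  exists a b : int, [/\ (b%:~R : R) \is a GRing.unit,
    r = a%:~R / b%:~R & x = a%:~R / b%:~R].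

Lemma unitR_neq0 (b : int) : (b%:~R : R) \is a GRing.unit -> b%:~R != 0 :> rat.
Proof.
by rewrite intr_eq0; apply: contraTneq => ->; rewrite unitr0.
Qed.

Lemma red_int (a : int) : red a%:~R a%:~R.
Proof. by exists a, 1; rewrite !divr1 unitr1. Qed.

Lemma red_nat (n : nat) : red n%:R n%:R.
Proof. by have := red_int n; rewrite -!pmulrn. Qed.

Lemma redD r s x y : red r x -> red s y -> red (r + s) (x + y).
Proof.
move=> [a [b [ub -> ->]]] [c [d [ud -> ->]]].
exists (a * d + c * b), (b * d); rewrite !intrD !intrM unitrM ub ud; split=> //.
  by field; rewrite !unitR_neq0.
by rewrite invrM // mulrDl !mulrA mulrK // (mulrAC c%:~R) mulrK.
Qed.

Lemma redM r s x y : red r x -> red s y -> red (r * s) (x * y).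
Proof.
move=> [a [b [ub -> ->]]] [c [d [ud -> ->]]].
exists (a * c), (b * d); rewrite !intrM unitrM ub ud; split=> //.
  by rewrite invfM mulrACA.
by rewrite invrM // mulrACA [_^-1 * _^-1]mulrC.
Qed.

Lemma redN r x : red r x -> red (- r) (- x).
Proof.
by move=> [a [b [ub -> ->]]]; exists (- a), b; rewrite !mulrNz !mulNr.
Qed.

Lemma redB r s x y : red r x -> red s y -> red (r - s) (x - y).
Proof. by move=> hr hs; apply: redD => //; apply: redN. Qed.

Lemma redV r x : red r x -> x \is a GRing.unit -> red r^-1 x^-1.
Proof.
move=> [a [b [ub -> ->]]]; rewrite unitrMl ?unitrV // => ua; exists b, a.
by split; rewrite ?ua //; [rewrite invfM invrK mulrC | rewrite invrM ?unitrV // invrK].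
Qed.

Lemma red_div r s x y : red r x -> red s y -> y \is a GRing.unit ->
  red (r / s) (x / y).
Proof. by move=> hr hs uy; apply/redM/redV. Qed.

Lemma red_exp r x m : red r x -> red (r ^+ m) (x ^+ m).
Proof.
move=> h; elim: m => [|m IH]; first exact: (red_nat 1).
by rewrite !exprS; apply: redM.
Qed.

Lemma red_prod (I : Type) (s : seq I) (P : pred I) (f : I -> rat) (g : I -> R) :
  (forall i, P i -> red (f i) (g i)) ->
  red (\prod_(i <- s | P i) f i) (\prod_(i <- s | P i) g i).
Proof. by move=> h; apply: (big_ind2 red) => //; [exact: (red_nat 1) | by move=> *; apply: redM]. Qed.

Lemma red_sum (I : Type) (s : seq I) (P : pred I) (f : I -> rat) (g : I -> R) :
  (forall i, P i -> red (f i) (g i)) ->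
  red (\sum_(i <- s | P i) f i) (\sum_(i <- s | P i) g i).
Proof. by move=> h; apply: (big_ind2 red) => //; [exact: (red_nat 0) | by move=> *; apply: redD]. Qed.

(** Cross-multiplication gives an equality of integers, which survives reduction. A sum and its
    closed form can thus be reduced separately and compared. *)
Lemma red_inj r x y : red r x -> red r y -> x = y.
Proof.
move=> [a [b [ub -> ->]]] [c [d [ud e ->]]].
have : a * d = c * b.
  apply: (intr_inj (R := rat)); rewrite !intrM; apply/eqP.
  by rewrite -eqr_div ?unitR_neq0 //; apply/eqP.
move/(congr1 (fun m : int => m%:~R : R)); rewrite !intrM => h.
by apply: (mulIr ub); rewrite divrK // mulrAC -h mulrK.
Qed.

Lemma red_Zloc r x : red r x -> r \in Zloc p.
Proof.
move=> [a [b [ub ->]] _]; rewrite inE /=.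
have b0 := unitR_neq0 ub; set r' := a%:~R / b%:~R.
have e : numq r' * b = a * denq r'.
  apply: (intr_inj (R := rat)); rewrite !intrM.
  have := divq_num_den r'; rewrite {2}/r' => /eqP.
  by rewrite eqr_div ?intr_eq0 ?denq_neq0 -?(intr_eq0 rat) // => /eqP ->.
have db : (`|denq r'| %| `|b|)%N.
  rewrite -(Gauss_dvdr (m := `|denq r'|) (n := `|numq r'|)) -?abszM ?e ?abszM ?dvdn_mull //.
  by rewrite coprime_sym; apply: coprime_num_den.
rewrite intR_unit in ub.
by rewrite prime_coprime //; apply: contra ub => /dvdn_trans; apply.
Qed.

Lemma red_congr r s x : red r x -> red s x -> Zloc_congr p (p ^ 2) r s.
Proof.
move=> hr hs; split; [exact: red_Zloc hr | exact: red_Zloc hs|].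
have [a [b [ub e ea]]] := redB hr hs.
rewrite subrr in ea.
have : (a%:~R : R) == 0 by rewrite -(divrK ub a%:~R) -ea mul0r.
rewrite intR_eq0 => /dvdnP[q aq].
(* [aq] concerns the absolute value of [a]; [sgz a] restores the sign. *)
exists ((sgz a * q)%:~R / b%:~R).
  by apply: (@red_Zloc _ ((sgz a * q)%:~R / b%:~R)); exists (sgz a * q), b.
rewrite e mulrA; congr (_ / _).
rewrite {1}[a]intEsg aq; ring.
Qed.

End ModSquare.

(** * Truncated hypergeometric sums modulo [p ^ 2] *)

Section HypergeometricModSquare.

Variable p : nat.
Hypothesis p_prime : prime p.
Hypothesis p_gt3 : (3 < p)%N.
Local Notation R := (zmod_sqr p).

Lemma unitR_lt k : (0 < k < p)%N -> (k%:R : R) \is a GRing.unit.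
Proof. by move=> /andP[k0 kp]; rewrite natR_unit // gtnNdvd. Qed.

Lemma unitR2 : (2 : R) \is a GRing.unit.
Proof. by apply: unitR_lt; rewrite (ltn_trans _ p_gt3). Qed.

Lemma unitR3 : (3 : R) \is a GRing.unit.
Proof. by apply: unitR_lt. Qed.

Lemma unitR8 : (8 : R) \is a GRing.unit.
Proof. by rewrite (_ : 8 = 2 ^+ 3) ?unitrX ?unitR2 //; ring. Qed.

Lemma unitR24 : (24 : R) \is a GRing.unit.
Proof. by rewrite (_ : 24 = 3 * 8) ?unitrM ?unitR3 ?unitR8 //; ring. Qed.

Lemma red_tau (r : rat) (x : R) k :
  (forall j, (j < k)%N -> (1 + j%:R + 3 * x : R) \is a GRing.unit) ->
  (k < p)%N -> @red p r x -> @red p (tau r k) (tau x k).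
Proof.
move=> h kp rx; apply: red_prod => -[j jk] _ /=.
have r1 := red_nat p 1; have r2 := red_nat p 2.
have r3 := red_nat p 3; have r8 := red_nat p 8.
have r9 := red_nat p 9; have rj := red_nat p j.
apply: redM; last by apply: red_div => //; apply: unitR8.
apply: red_div => //.
- apply: redM; repeat apply: redD => //; [|apply: red_div => //; apply: unitR3].
  by apply: redV => //; apply: unitR3.
- by apply: redM; repeat apply: redD => //; apply: redM.
by rewrite unitrM h //= addrC natr1 unitR_lt // (leq_ltn_trans jk).
Qed.

(** The slopes lie in [p R], an ideal of square zero, which is why these functions are closed under
    products and under inversion of units. *)
Definition affine_p (f : R -> R) := exists A B, forall t, f t = A + t * (p%:R * B).

Lemma affine_cst c : affine_p (fun=> c).
Proof. by exists c, 0 => t; rewrite !mulr0 addr0. Qed.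

Lemma affine_lin a c : affine_p (fun t => a + c * (t * p%:R)).
Proof. by exists a, c => t; ring. Qed.

Lemma affineM f g : affine_p f -> affine_p g -> affine_p (fun t => f t * g t).
Proof.
move=> [A [B Ef]] [C [D Eg]]; exists (A * C), (A * D + B * C) => t.
rewrite Ef Eg.
transitivity (A * C + t * (p%:R * (A * D + B * C)) + t ^+ 2 * (p%:R * p%:R) * (B * D)).
  by ring.
by rewrite (sqr_pR p_prime); ring.
Qed.

Lemma affineV f : affine_p f -> f 0 \is a GRing.unit -> affine_p (fun t => (f t)^-1).
Proof.
move=> [A [B Ef]]; rewrite Ef mul0r addr0 => uA.
exists A^-1, (- B * A^-1 ^+ 2) => t.
have e : f t * (A^-1 + t * (p%:R * (- B * A^-1 ^+ 2))) = 1.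
  have AV : A * A^-1 = 1 by rewrite divrr.
  transitivity (A * A^-1 * (1 - t * p%:R * B * A^-1) + t * p%:R * B * A^-1
     - (p%:R * p%:R) * (t * B * A^-1) ^+ 2); first by rewrite Ef; ring.
  by rewrite AV (sqr_pR p_prime); ring.
have uf : f t \is a GRing.unit.
  by apply/unitrP; exists (A^-1 + t * (p%:R * (- B * A^-1 ^+ 2))); rewrite mulrC e.
by apply: (mulrI uf); rewrite e divrr.
Qed.

Lemma affine_prod m (f : nat -> R -> R) : (forall i, (i < m)%N -> affine_p (f i)) ->
  affine_p (fun t => \prod_(i < m) f i t).
Proof.
elim: m => [|m IH] h.
  by exists 1, 0 => t; rewrite big_ord0; ring.
have [A [B E]] := affineM (IH (fun i im => h i (ltnW im))) (h m (ltnSn m)).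
by exists A, B => t; rewrite big_ord_recr /= E.
Qed.

Lemma affine_sum m (f : nat -> R -> R) : (forall i, (i < m)%N -> affine_p (f i)) ->
  affine_p (fun t => \sum_(i < m) f i t).
Proof.
elim: m => [|m IH] h.
  by exists 0, 0 => t; rewrite big_ord0; ring.
have [A [B E]] := IH (fun i im => h i (ltnW im)).
have [C [D E']] := h m (ltnSn m).
by exists (A + C), (B + D) => t; rewrite big_ord_recr /= E E'; ring.
Qed.

Lemma affine_sub f s t : affine_p f -> pmult (f s - f t).
Proof. by move=> [A [B E]]; exists ((s - t) * B); rewrite !E; ring. Qed.

Lemma affine_tau k : (k < p)%N -> affine_p (fun t => tau (t * p%:R) k).
Proof.
move=> kp; apply: (@affine_prod k (fun j t => (3^-1 + j%:R + t * p%:R) * (2 / 3 + j%:R + t * p%:R)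
     / ((1 + j%:R + 3 * (t * p%:R)) * (1 + j%:R)) * (9 / 8))) => j jk.
have al a : affine_p (fun t => a + t * p%:R).
  by have [A [B E]] := affine_lin a 1; exists A, B => t; rewrite -E mul1r.
apply: affineM; last exact: affine_cst.
apply: affineM; first by apply: affineM.
apply: (affineV (f := fun t => (1 + j%:R + 3 * (t * p%:R)) * (1 + j%:R))).
  by apply: affineM; [apply: affine_lin | apply: affine_cst].
have -> : 1 + j%:R = j.+1%:R :> R by rewrite addrC natr1.
by rewrite mul0r mulr0 addr0 unitrM !unitR_lt // (leq_ltn_trans jk).
Qed.

Definition tau_sum (t : R) : R := \sum_(k < p) tau (t * p%:R) k.

Lemma affine_tau_sum : affine_p tau_sum.
Proof. by apply: (@affine_sum p (fun k t => tau (t * p%:R) k)) => k; apply: affine_tau. Qed.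

(** Linear extrapolation to 0 from [t = - 1/3] and [t = - 2/3], where one numerator parameter of the
    series is a negative integer. *)
Lemma tau_sum_interp : tau_sum 0 = 2 * tau_sum (- 3^-1) - tau_sum (- (2 / 3)).
Proof. by have [A [B E]] := affine_tau_sum; rewrite !E; ring. Qed.

Lemma red_tau_sum (t : int) :
  @red p (\sum_(k < p) tau (t%:~R / 3 * p%:R : rat) k) (tau_sum (t%:~R / 3)).
Proof.
apply: red_sum => -[k kp] _ /=; apply: red_tau => //.
  move=> j jk.
  have -> : 1 + j%:R = j.+1%:R :> R by rewrite addrC natr1.
  apply: unit_pmult => //; first by rewrite unitR_lt // (leq_ltn_trans jk).
  by exists (3 * (t%:~R / 3)); ring.
apply: redM; last exact: red_nat.
by apply: red_div; [apply: red_int|apply: red_nat|apply: unitR3].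
Qed.

Lemma red_rising r x k : @red p r x -> @red p (rising r k) (rising x k).
Proof.
by move=> h; apply: red_prod => j _; apply: redD => //; apply: red_nat.
Qed.

Lemma unit_rising k (t : R) : (k < p)%N -> rising (1 + t * p%:R) k \is a GRing.unit.
Proof.
move=> kp; apply/rpred_prod => -[j jk] _ /=.
rewrite addrAC; have -> : 1 + j%:R = j.+1%:R :> R by rewrite addrC natr1.
apply: unit_pmult => //; first by rewrite unitR_lt // (leq_ltn_trans jk).
by exists t; ring.
Qed.

(** The shift [- p / 3 = - n - 2/3] makes the series terminate, and its closed form has the factor
    [n + 2/3 = p / 3] in the numerator. A function satisfying [affine_p] is constant modulo [p],
    which carries the divisibility to 0. *)
Lemma tau_sum_pmult n : p = (3 * n + 2)%N -> pmult (tau_sum 0).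
Proof.
move=> pE.
have n0 : (0 < n)%N by lia.
have H : pmult (tau_sum ((-1)%:~R / 3)).
  have := red_tau_sum (-1).
  have -> : (-1)%:~R / 3 * p%:R = - n%:R - 2 / 3 :> rat.
    by rewrite pE natrD natrM; field.
  rewrite (@sum_tau_trunc _ n); [|by right|by lia].
  rewrite sum_tau_23 // => h1.
  have e3 : p%:R / 3 = n%:R + 2 / 3 :> R.
    apply: (mulIr unitR3); rewrite divrK ?unitR3 // mulrDl divrK ?unitR3 //.
    by rewrite -natrM -natrD mulnC -pE.
  have u13 : rising (3^-1 : R) n \is a GRing.unit.
    apply/rpred_prod => -[j jk] _ /=.
    rewrite -(unitrMl _ unitR3) mulrDl mulVr ?unitR3 //.
    by rewrite -natrM addrC natr1 unitR_lt //; lia.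
  have h2 : @red p (rising (n%:R + 2 / 3) n / (8 ^+ n * rising 3^-1 n))
     (rising (n%:R + 2 / 3) n / (8 ^+ n * rising 3^-1 n)).
    have r2 := red_nat p 2; have r3 := red_nat p 3.
    apply: red_div; rewrite ?unitrM ?unitrX ?unitR8 ?u13 //.
      by apply/red_rising/redD; [exact: red_nat | apply: red_div => //; apply: unitR3].
    apply: redM; first by apply/red_exp/red_nat.
    by apply/red_rising/redV => //; apply: unitR3.
  rewrite (red_inj h1 h2); apply: pmultMr.
  have -> : rising (n%:R + 2 / 3 : R) n = p%:R / 3 * rising (1 + p%:R / 3) n.-1.
    by rewrite -{2}(prednK n0) risingSl e3.
  by do 2!apply: pmultMr; exists 1; rewrite mulr1.
rewrite (_ : tau_sum 0 = (tau_sum 0 - tau_sum ((-1)%:~R / 3)) + tau_sum ((-1)%:~R / 3)); last by ring.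
by apply: pmultD => //; apply: affine_sub affine_tau_sum.
Qed.

End HypergeometricModSquare.

(** * Evaluation of the sums for [p = 3 n + 1] *)

Lemma rising_add (R : nzRingType) (x : R) a b :
  rising x (a + b) = rising x a * rising (x + a%:R) b.
Proof.
rewrite /rising big_split_ord /=; congr (_ * _); apply: eq_bigr => i _.
by rewrite natrD addrA.
Qed.

Lemma rising_shift (R : comNzRingType) (x : R) k :
  x * rising (1 + x) k = rising x k * (x + k%:R).
Proof. by rewrite -risingSl risingS. Qed.

Lemma rising1 (R : nzRingType) k : rising (1 : R) k = k`!%:R.
Proof.
elim: k => [|k IH]; first by rewrite /rising big_ord0.
by rewrite risingS IH factS addrC natr1 mulnC natrM.
Qed.

Lemma rising_opp (R : comNzRingType) (x : R) k :
  rising (x - k%:R) k = (-1) ^+ k * rising (1 - x) k.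
Proof.
rewrite /rising (reindex_inj rev_ord_inj) /=.
rewrite -[X in (-1) ^+ X]card_ord -prodr_const -big_split /=.
apply: eq_bigr => i _; rewrite natrB // -natr1; ring.
Qed.

Section Split.

Variables (p n : nat).
Hypothesis p_prime : prime p.
Hypothesis p_gt3 : (3 < p)%N.
Hypothesis pE : p = (3 * n + 1)%N.
Local Notation R := (zmod_sqr p).
Local Notation C := ('C(2 * n, n)%:R : R).

Lemma third_gt0 : (0 < n)%N. Proof. by case: n pE p_gt3 => [->|]. Qed.

Lemma natR_third : p%:R = 3 * n%:R + 1 :> R.
Proof. by rewrite -natrM natr1 -addn1 -pE. Qed.

Lemma sign_third (A : pzRingType) : (-1) ^+ n = 1 :> A.
Proof.
have : odd p by case: (even_prime p_prime) p_gt3 => [->|].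
by rewrite -signr_odd pE oddD oddM /= addbT => /negPf ->.
Qed.

Lemma unit_fact k : (k < p)%N -> (k`!%:R : R) \is a GRing.unit.
Proof. by rewrite natR_unit // => kp; rewrite prime_dvd_fact // -ltnNge. Qed.

(** [u t] and [w t] are the lower and upper halves of [rising (1 + t p) (2 n)], deformations of [n!]
    and of [(n + 1) ... (2 n)]. *)
Let u (t : R) : R := rising (1 + t * p%:R) n.
Let w (t : R) : R := rising (1 + t * p%:R + n%:R) n.

Lemma rising_p0 : u 0 = n`!%:R. Proof. by rewrite /u mul0r addr0 rising1. Qed.

(** Factorwise, [(k + s p) (k + t p) = k (k + (s + t) p)] modulo [p ^ 2]. *)
Lemma rising_pM s t : u s * u t = n`!%:R * u (s + t).
Proof.
rewrite -rising_p0 /u /rising -!big_split /=; apply: eq_bigr => i _.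
transitivity ((1 + 0 * p%:R + i%:R) * (1 + (s + t) * p%:R + i%:R) + s * t * (p%:R * p%:R) : R); first by ring.
by rewrite sqr_pR // mulr0 addr0.
Qed.

(* [k] and [p - k] both lie in [n + 1 .. 2 n], and
   [(k + t p) (p - k + t p) = k (p - k)] modulo [p ^ 2]. *)
Lemma upper_half_const t : w t = w 0.
Proof.
have w2 s : w s * w s = \prod_(i < n) ((1 + n%:R + i%:R) * (n%:R + n%:R - i%:R)).
  rewrite {2}/w {1}/w /rising [X in _ * X](reindex_inj rev_ord_inj) -big_split /=.
  apply: eq_bigr => i _; rewrite natrB // -natr1.
  transitivity ((1 + n%:R + i%:R) * (n%:R + n%:R - i%:R) + s * p%:R * (3 * n%:R + 1)
     + s * s * (p%:R * p%:R) : R); first by ring.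
  by rewrite -natR_third -mulrA sqr_pR // !mulr0 !addr0.
(* [w t] and [w 0] have equal squares and agree modulo [p], so their sum is a unit and their
   difference vanishes. *)
have d : pmult (w t - w 0).
  apply: pmult_prodB => // i; exists t; rewrite mul0r; ring.
have e : (w t - w 0) * (w t + w 0) = 0.
  by rewrite -subr_sqr !expr2 !w2 subrr.
have us : w t + w 0 \is a GRing.unit.
  have -> : w t + w 0 = 2 * w 0 + (w t - w 0) by ring.
  apply: unit_pmult => //; rewrite unitrM unitR2 //=.
  have np : (n + n < p)%N by lia.
  by have := unit_rising p_prime 0 np; rewrite rising_add unitrM => /andP[].
by apply/eqP; rewrite -subr_eq0; apply/eqP; apply: (mulIr us); rewrite mul0r.
Qed.

Lemma upper_half0 : w 0 = n`!%:R * C.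
Proof.
apply: (mulrI (unit_fact (_ : n < p)%N)); first by lia.
have -> : n`!%:R * w 0 = (2 * n)`!%:R.
  rewrite -rising_p0 /u /w -rising_add mul0r addr0 rising1; congr (_`!%:R); lia.
rewrite mulrA -!natrM; congr (_%:R).
have /bin_fact <- : (n <= 2 * n)%N by lia.
have -> : (2 * n - n = n)%N by lia.
by rewrite mulnC.
Qed.

Lemma fact_2n : (2 * n)`!%:R = n`!%:R ^+ 2 * C :> R.
Proof.
have /bin_fact <- : (n <= 2 * n)%N by lia.
have -> : (2 * n - n = n)%N by lia.
by rewrite !natrM; ring.
Qed.

(** Congruent to 1 modulo [p], since [8 ^+ n = 2 ^+ p.-1] and [u 3^-1] agrees with [u 0 = n!] modulo
    [p]. *)
Let v : R := u 3^-1 / (8 ^+ n * n`!%:R).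

(** Reflection of the product, from [1/3 = p/3 - n]; the sign is 1 by [sign_third]. *)
Lemma rising_third : rising (3^-1 : R) n = u (- 3^-1).
Proof.
have e : 3^-1 = 3^-1 * p%:R - n%:R :> R.
  by rewrite natR_third mulrDr mulrA mulVr ?unitR3 // mul1r mulr1 addrAC subrr add0r.
by rewrite [in LHS]e rising_opp sign_third mul1r /u mulNr.
Qed.

(** The closed form has [u (- 1/3)] in the denominator; [u (- 1/3) u (1/3) = n! ^ 2] trades it for
    [u (1/3)] in the numerator. *)
Lemma tau_sum_13 : tau_sum (p := p) (- 3^-1) = C * v.
Proof.
have n0 := third_gt0.
have un : (n`!%:R : R) \is a GRing.unit by apply: unit_fact; lia.
have u8 : (8 ^+ n : R) \is a GRing.unit by rewrite unitrX ?unitR8.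
have uu s : u s \is a GRing.unit by apply: unit_rising => //; lia.
have h1 := red_tau_sum p_prime p_gt3 (-1).
have e1 : (-1)%:~R / 3 = - 3^-1 :> R by rewrite mulN1r.
have e2 : (-1)%:~R / 3 * p%:R = - n%:R - 3^-1 :> rat.
  by rewrite pE natrD natrM; field.
rewrite e1 e2 (@sum_tau_trunc _ n) in h1; [|by left|by lia].
rewrite sum_tau_13 // in h1.
have h2 : @red p ((2 * n)`!%:R / (8 ^+ n * n`!%:R * rising 3^-1 n))
   ((2 * n)`!%:R / (8 ^+ n * n`!%:R * rising 3^-1 n)).
  apply: red_div; rewrite ?unitrM ?u8 ?un ?rising_third ?uu //; first exact: red_nat.
  apply: redM; first by apply: redM; [apply/red_exp/red_nat | apply: red_nat].
  by rewrite -rising_third; apply/red_rising/redV; [apply: red_nat | apply: unitR3].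
rewrite (red_inj h1 h2) rising_third fact_2n.
have uD : 8 ^+ n * n`!%:R * u (- 3^-1) \is a GRing.unit by rewrite !unitrM u8 un uu.
apply: (mulIr uD); rewrite divrK //.
have uD' : (8 ^+ n * n`!%:R : R) \is a GRing.unit by rewrite unitrM u8 un.
transitivity (C * (v * (8 ^+ n * n`!%:R)) * u (- 3^-1)); last by ring.
rewrite /v divrK // -mulrA rising_pM subrr rising_p0; ring.
Qed.

Lemma tau_sum_23 : tau_sum (p := p) (- (2 / 3)) = C * v ^+ 2.
Proof.
have n0 := third_gt0.
have un : (n`!%:R : R) \is a GRing.unit by apply: unit_fact; lia.
have u8 : (8 ^+ n : R) \is a GRing.unit by rewrite unitrX ?unitR8.
have uu s : u s \is a GRing.unit by apply: unit_rising => //; lia.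
have h1 := red_tau_sum p_prime p_gt3 (-2).
have e1 : (-2)%:~R / 3 = - (2 / 3) :> R by rewrite mulNr.
have e2 : (-2)%:~R / 3 * p%:R = - (2 * n)%:R - 2 / 3 :> rat.
  by rewrite pE natrD !natrM; field.
rewrite e1 e2 (@sum_tau_trunc _ (2 * n)) in h1; [|by right|by lia].
rewrite sum_tau_23 ?muln_gt0 // in h1.
set p3 : rat := p%:R / 3.
have p30 : p3 != 0 by rewrite mulf_neq0 // pnatr_eq0 -lt0n prime_gt0.
have p3E : p3 = n%:R + 3^-1 by rewrite /p3 pE natrD natrM; field.
have n00 : 0 <= n%:R :> rat by [].
(* The non-unit [p3] occurs above, as [2 n + 2/3 = 2 p3], and below, as [n + 1/3 = p3]. It is
   cancelled over the rationals, before reduction. *)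
have eq1 : rising ((2 * n)%:R + 2 / 3) (2 * n) / (8 ^+ (2 * n) * rising 3^-1 (2 * n))
   = rising (1 + 2 * p3) (2 * n) / (8 ^+ (2 * n) * (rising 3^-1 n * rising (1 + p3) n)).
  have -> : (2 * n)%:R + 2 / 3 = 2 * p3 by rewrite p3E natrM; ring.
  have -> : rising 3^-1 (2 * n) = rising 3^-1 n * rising p3 n.
    rewrite mul2n -addnn rising_add p3E addrC; congr (_ * rising _ _); ring.
  have x1 := rising_shift (2 * p3) (2 * n); have x2 := rising_shift p3 n.
  have d1 : 2 * p3 + (2 * n)%:R != 0 by rewrite natrM; apply/eqP; rewrite p3E; lra.
  have d2 : p3 + n%:R != 0 by apply/eqP; rewrite p3E; lra.
  have y1 : rising (2 * p3) (2 * n) = 2 * p3 * rising (1 + 2 * p3) (2 * n) / (2 * p3 + (2 * n)%:R).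
    by rewrite x1 mulfK.
  have y2 : rising p3 n = p3 * rising (1 + p3) n / (p3 + n%:R) by rewrite x2 mulfK.
  have r1 : rising (3^-1 : rat) n != 0 by apply: rising_neq0.
  have r2 : rising (1 + p3) n != 0 by apply: rising_neq0; rewrite p3E; lra.
  have r8 : 8 ^+ (2 * n) != 0 :> rat by rewrite expf_neq0.
  rewrite y1 y2; move: (rising (1 + _) _) (rising (1 + _) _) (8 ^+ _) r1 r2 r8 => a b c r1 r2 r8.
  rewrite natrM; field; rewrite p30 r1 r2 r8 d2 /=.
  by apply/eqP; rewrite p3E; lra.
rewrite eq1 in h1.
have r3 : @red p p3 (p%:R / 3) by apply: red_div; rewrite ?unitR3 //; apply: red_nat.
have F1 : rising (1 + 2 * (p%:R / 3)) (2 * n) = u (2 / 3) * w (2 / 3).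
  rewrite mul2n -addnn rising_add /u /w.
  by have -> : 2 * (p%:R / 3) = 2 / 3 * p%:R :> R by ring.
have F2 : rising (1 + p%:R / 3) n = u 3^-1 by rewrite /u mulrC.
have uD : 8 ^+ (2 * n) * (u (- 3^-1) * u 3^-1) \is a GRing.unit.
  by rewrite !unitrM exprM unitrX ?unitrX ?unitR8 // !uu.
have h2 : @red p (rising (1 + 2 * p3) (2 * n) / (8 ^+ (2 * n) * (rising 3^-1 n * rising (1 + p3) n)))
   (u (2 / 3) * w (2 / 3) / (8 ^+ (2 * n) * (u (- 3^-1) * u 3^-1))).
  apply: red_div => //.
    rewrite -F1; apply/red_rising/redD; first exact: (red_nat p 1).
    by apply: redM => //; apply: red_nat.
  apply: redM; first by apply/red_exp/red_nat.
  rewrite -rising_third -F2; apply: redM; apply: red_rising.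
    by apply/redV; [apply: red_nat | apply: unitR3].
  by apply/redD => //; exact: (red_nat p 1).
rewrite (red_inj h1 h2).
apply: (mulIr uD); rewrite divrK //.
(* The upper half gives [n! C] whatever the shift; [u (2/3)] will come from [u (1/3) ^+ 2]. *)
rewrite upper_half_const upper_half0.
have uD' : (8 ^+ n * n`!%:R : R) \is a GRing.unit by rewrite unitrM u8 un.
have -> : u (- 3^-1) * u 3^-1 = n`!%:R ^+ 2 by rewrite rising_pM addrC subrr rising_p0; ring.
have -> : C * v ^+ 2 * (8 ^+ (2 * n) * n`!%:R ^+ 2) = C * (v * (8 ^+ n * n`!%:R)) ^+ 2.
  by rewrite mulnC exprM; ring.
rewrite /v divrK // expr2 rising_pM.
have -> : 3^-1 + 3^-1 = 2 / 3 :> R by ring.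
ring.
Qed.

(** [2 v - v ^+ 2 = 1 - (v - 1) ^+ 2], and [v - 1] has square zero. *)
Lemma tau_sum_binom : tau_sum (p := p) 0 = C.
Proof.
rewrite tau_sum_interp // tau_sum_13 tau_sum_23.
have un : (n`!%:R : R) \is a GRing.unit by apply: unit_fact; lia.
have u8 : (8 ^+ n : R) \is a GRing.unit by rewrite unitrX ?unitR8.
have d : pmult (v - 1).
  have uD : (8 ^+ n * n`!%:R : R) \is a GRing.unit by rewrite unitrM u8 un.
  have -> : v - 1 = (u 3^-1 - 8 ^+ n * n`!%:R) / (8 ^+ n * n`!%:R).
    by rewrite /v mulrBl divrr.
  apply: pmultMr.
  have -> : u 3^-1 - 8 ^+ n * n`!%:R = (u 3^-1 - u 0) - (8 ^+ n - 1) * n`!%:R by rewrite rising_p0; ring.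
  apply: pmultB; first by apply: pmult_prodB => // i; exists 3^-1; ring.
  apply: pmultMr.
  have -> : (8 : R) ^+ n = 2 ^+ p.-1.
    by rewrite pE addn1 /= exprM; congr (_ ^+ _); ring.
  by apply: pmult_fermat => //; apply: unitR2.
transitivity (C - C * (v - 1) ^+ 2); first by ring.
by rewrite (pmult_sqr p_prime d) mulr0 subr0.
Qed.

End Split.

(** * The Teichmueller character modulo [p ^ 2] *)

Section Teichmuller.

Variable p : nat.
Hypothesis p_prime : prime p.
Local Notation R := (zmod_sqr p).
Local Notation F := ('F_p).

Definition liftFp (t : F) : R := (t : nat)%:R.
(** A single [p]-th power suffices modulo [p ^ 2]: by [pmult_frobenius] it does not depend on the
    lift. *)
Definition teich (t : F) : R := liftFp t ^+ p.

Lemma natF_eq (a b : nat) : (a%:R == b%:R :> F) = (a == b %[mod p])%N.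
Proof. by rewrite -val_eqE /= !val_Fp_nat. Qed.

Lemma natF_pmult (a b : nat) : a%:R = b%:R :> F -> pmult (a%:R - b%:R : R).
Proof.
move/eqP; rewrite natF_eq.
wlog ab : a b / (b <= a)%N => [H|].
  have [/H|/ltnW/H h] := leqP b a; first by apply.
  rewrite eq_sym => /h/pmultN; by rewrite opprB.
rewrite eqn_mod_dvd // => h; rewrite -natrB //; exact: nat_pmult.
Qed.

Lemma liftFp_pmult (s t : F) : pmult (liftFp s - liftFp t) -> s = t.
Proof.
wlog ab : s t / ((t : nat) <= (s : nat))%N => [H|].
  have [/H|/ltnW/H h] := leqP (t : nat) (s : nat); first by apply.
  by move/pmultN; rewrite opprB => /h.
rewrite /liftFp -natrB // => /pmult_nat -/(_ p_prime).
rewrite -eqn_mod_dvd // -natF_eq => /eqP.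
by rewrite !natr_Zp.
Qed.

Lemma natFK (t : F) : (t : nat)%:R = t :> F. Proof. exact: natr_Zp. Qed.

Lemma liftFpM (s t : F) : pmult (liftFp (s * t) - liftFp s * liftFp t).
Proof. by rewrite /liftFp -natrM; apply: natF_pmult; rewrite natrM !natFK. Qed.

Lemma liftFpB1 (t : F) : pmult (liftFp (1 - t) - (1 - liftFp t)).
Proof.
rewrite opprB addrA /liftFp -natrD; apply: (natF_pmult (b := 1)).
by rewrite natrD !natFK subrK.
Qed.

Lemma liftFp0 : liftFp 0 = 0. Proof. by []. Qed.

Lemma teich0 : teich 0 = 0.
Proof. by rewrite /teich liftFp0 expr0n gtn_eqF // prime_gt0. Qed.

Lemma teichM : {morph teich : s t / s * t}.
Proof.
move=> s t; rewrite /teich -exprMn; apply: pmult_frobenius => //; exact: liftFpM.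
Qed.

Lemma teich1 : teich 1 = 1.
Proof.
rewrite -[RHS](expr1n _ p); apply: pmult_frobenius => //.
exact: (natF_pmult (b := 1) (natFK _)).
Qed.

Lemma teichX t m : teich (t ^+ m) = teich t ^+ m.
Proof.
by elim: m => [|m IH]; rewrite ?expr0 ?teich1 // !exprS teichM IH.
Qed.

Lemma teich_lift t : pmult (teich t - liftFp t).
Proof.
rewrite /teich /liftFp -natrX; apply: natF_pmult.
by rewrite natrX natFK -{2}[t](expf_card t) card_Fp.
Qed.

Lemma teichB1 t : teich (1 - t) = (1 - teich t) ^+ p.
Proof.
apply: pmult_frobenius => //.
have -> : liftFp (1 - t) - (1 - teich t) =
  (liftFp (1 - t) - (1 - liftFp t)) + (teich t - liftFp t) by ring.
by apply: pmultD; [apply: liftFpB1 | apply: teich_lift].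
Qed.

Lemma teichB_unit s t : s != t -> teich s - teich t \is a GRing.unit.
Proof.
move=> st; case: (pmult_or_unit p_prime (teich s - teich t)) => // h.
have : pmult (liftFp s - liftFp t).
  have -> : liftFp s - liftFp t = teich s - teich t - (teich s - liftFp s) + (teich t - liftFp t) by ring.
  by apply: pmultD; [apply: pmultB|]; rewrite //; apply: teich_lift.
by move/liftFp_pmult => e; rewrite e eqxx in st.
Qed.

Lemma Fp_pred (t : F) : t != 0 -> t ^+ p.-1 = 1.
Proof.
move=> t0; apply: (mulfI t0); rewrite mulr1 -exprS prednK ?prime_gt0 //.
by rewrite -{2}[t](expf_card t) card_Fp.
Qed.

Lemma card_Fp_neq0 : #|[pred t : F | t != 0]| = p.-1.
Proof.
have -> : p.-1 = #|predC1 (0 : F)| by rewrite cardC1 card_Fp.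
by apply: eq_card => t; rewrite !inE.
Qed.

Lemma exists_Fp_expn_neq1 m : (0 < m < p.-1)%N -> exists2 g : F, g != 0 & g ^+ m != 1.
Proof.
move=> /andP[m0 mp].
case: (pickP [pred g : F | (g != 0) && (g ^+ m != 1)]) => [g /= /andP[]|h]; first by exists g.
have := @max_unity_roots F m (enum [pred g : F | g != 0]) m0 _ (enum_uniq _).
have -> : all m.-unity_root (enum [pred g : F | g != 0]).
  apply/allP => g; rewrite mem_enum inE => g0.
  by have := h g; rewrite /= g0 unity_rootE => /negbFE.
have -> : size (enum [pred g : F | g != 0]) = p.-1.
  by rewrite -cardE card_Fp_neq0.
by rewrite leqNgt mp => /(_ isT).
Qed.

(** Orthogonality: scaling by a [g] with [g ^+ m != 1] multiplies the sum by [teich (g ^+ m)], and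
    [teich (g ^+ m) - 1] is a unit, not merely nonzero, so it can be cancelled. *)
Lemma sum_teichX m : \sum_(t : F | t != 0) teich t ^+ m
   = if (p.-1 %| m)%N then p.-1%:R else 0.
Proof.
have p1 : (0 < p.-1)%N by rewrite -ltnS prednK ?prime_gt0 ?prime_gt1.
case: ifPn => [/dvdnP[q ->]|pm].
  rewrite (eq_bigr (fun=> 1)) => [|t t0].
    by rewrite sumr_const card_Fp_neq0.
  by rewrite mulnC -teichX exprM Fp_pred // expr1n teich1.
have [|g g0 gm] := @exists_Fp_expn_neq1 (m %% p.-1).
  by rewrite ltn_mod p1 andbT lt0n.
have ug : teich (g ^+ m) - teich 1 \is a GRing.unit.
  apply: teichB_unit; apply: contraNneq gm => e.
  by rewrite -[X in _ == X]e {2}(divn_eq m p.-1) exprD mulnC exprM Fp_pred // expr1n mul1r.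
apply: (mulrI ug); rewrite mulr0 mulrBl teich1 mul1r.
apply/eqP; rewrite subr_eq0; apply/eqP.
rewrite [RHS](reindex_onto (fun s => g * s) (fun s => g^-1 * s)) /=; last first.
  by move=> t _; rewrite mulrA divff ?mul1r.
rewrite mulr_sumr; apply: eq_big => [s|s _].
  by rewrite mulf_eq0 (negPf g0) mulrA mulVf // mul1r eqxx andbT.
by rewrite teichX teichM exprMn.
Qed.

Lemma sum_teich_binom a N :
  \sum_(t : F | t != 0) teich t ^+ a * (1 - teich t) ^+ N
   = p.-1%:R * \sum_(j < N.+1 | (p.-1 %| a + j)%N) (-1) ^+ j * 'C(N, j)%:R.
Proof.
rewrite (eq_bigr (fun t => \sum_(j < N.+1) ((-1) ^+ j * 'C(N, j)%:R) * teich t ^+ (a + j))); last first.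
  move=> t _; rewrite exprBn mulr_sumr; apply: eq_bigr => j _.
  by rewrite expr1n mulr1 exprD -mulr_natr; ring.
rewrite exchange_big /= mulr_sumr [RHS]big_mkcond /=; apply: eq_bigr => j _.
by rewrite -mulr_sumr sum_teichX; case: ifP => _; rewrite ?mulr0 // mulrC.
Qed.

Variable n : nat.
Hypothesis p_gt3 : (3 < p)%N.
Hypothesis pE : p = (3 * n + 1)%N.
Local Notation C := ('C(2 * n, n)%:R : R).

Lemma p_pred : p.-1 = (3 * n)%N. Proof. by rewrite pE addn1. Qed.

Lemma sum_teich_2n :
  \sum_(t : F | t != 0) teich t ^+ (2 * n) * (1 - teich t) ^+ (2 * n) = (p%:R - 1) * C.
Proof.
have n0 := third_gt0 p_gt3 pE.
have hn : (n < (2 * n).+1)%N by lia.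
rewrite sum_teich_binom -subn1 natrB ?prime_gt0 //; congr (_ * _).
(* Between [2 n] and [4 n] the only multiple of [p - 1 = 3 n] is [3 n], so only [j = n] survives. *)
rewrite (big_pred1 (Ordinal hn)) /=; first by rewrite (sign_third p_prime p_gt3 pE) mul1r.
move=> [j jn]; rewrite /= subn1 p_pred -val_eqE /=.
apply/idP/eqP => [/dvdnP[q]|->]; last by apply/dvdnP; exists 1%N; lia.
by case: q => [|[|q]]; nia.
Qed.

Lemma sum_teich_5n :
  \sum_(t : F | t != 0) teich t ^+ (2 * n) * (1 - teich t) ^+ (5 * n)
   = (p%:R - 1) * (2 * 'C(5 * n, n)%:R).
Proof.
have n0 := third_gt0 p_gt3 pE.
have hn : (n < (5 * n).+1)%N by lia.
have h4n : (4 * n < (5 * n).+1)%N by lia.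
rewrite sum_teich_binom -subn1 natrB ?prime_gt0 //; congr (_ * _).
(* Between [2 n] and [7 n] lie the multiples [3 n] and [6 n]: the indices [n] and [4 n], with equal
   binomials. *)
rewrite (bigD1 (Ordinal hn)) /=; last by rewrite subn1 p_pred; apply/dvdnP; exists 1%N; lia.
rewrite (big_pred1 (Ordinal h4n)) /=.
  have -> : (4 * n = n * 4)%N by lia.
  rewrite exprM (sign_third p_prime p_gt3 pE) expr1n.
  rewrite -(@bin_sub (5 * n) (n * 4)); last by lia.
  have -> : (5 * n - n * 4 = n)%N by lia.
  ring.
move=> [j jn]; rewrite /= subn1 p_pred -!val_eqE /=.
apply/andP/eqP => [[/dvdnP[q] e /eqP jn']|->].
  by move: e jn'; case: q => [|[|[|q]]]; nia.
by split; [apply/dvdnP; exists 2%N; lia | apply/eqP; lia].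
Qed.

(** As [5 n = 2 n + p - 1], the product [n! 'C(5 n, n)] is [(n + p) ... (2 n + p - 1)]. Shifting it
    by one gives [w 1 = w 0 = n! C], so ['C(5 n, n)] is [C (n + p) / (2 n + p)]. *)
Lemma bin_5n : 2 * n%:R * (2 * 'C(5 * n, n)%:R - C) = p%:R * C.
Proof.
have n0 := third_gt0 p_gt3 pE.
have un : (n`!%:R : R) \is a GRing.unit by apply: unit_fact => //; lia.
have e1 : n`!%:R * 'C(5 * n, n)%:R = rising (n%:R + p%:R) n :> R.
  rewrite -natrM mulnC bin_ffact ffact_prod natr_prod /rising.
  rewrite (reindex_inj rev_ord_inj) /=; apply: eq_bigr => i _.
  by rewrite -!natrD; congr (_%:R); have := ltn_ord i; lia.
have e2 : (n%:R + p%:R) * rising (1 + (n%:R + p%:R)) n = rising (n%:R + p%:R) n * (n%:R + p%:R + n%:R) :> R.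
  exact: rising_shift.
have e3 : rising (1 + (n%:R + p%:R)) n = n`!%:R * C.
  rewrite -upper_half0 // -(upper_half_const p_prime p_gt3 pE 1) mul1r; congr rising; ring.
have up : n%:R + p%:R + n%:R \is a @GRing.unit R.
  have -> : n%:R + p%:R + n%:R = (2 * n)%:R + p%:R * 1 :> R by rewrite natrM; ring.
  by apply: unit_pmult => //; [apply: unitR_lt => //; lia | apply: pmult_p].
apply: (mulrI up); apply: (mulrI un).
transitivity (2 * n%:R * (2 * (n`!%:R * 'C(5 * n, n)%:R * (n%:R + p%:R + n%:R))
  - (n%:R + p%:R + n%:R) * (n`!%:R * C)) : R).
  ring.
rewrite e1 -e2 e3.
transitivity ((n%:R + p%:R + n%:R) * (n`!%:R * (p%:R * C)) - (p%:R * p%:R) * (n`!%:R * C)); first by ring.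
by rewrite sqr_pR // mul0r subr0; ring.
Qed.

(* With [x = 1 - teich t] one has [x ^ (3 n) = 1] modulo [p], hence
   [x ^ (2 n p) = x ^ (2 n) (1 + 2 n (x ^ (3 n) - 1))] modulo [p ^ 2]: the sum is
   a combination of [sum_teich_2n] and [sum_teich_5n]. *)
Lemma teich_jacobi :
  \sum_t teich t ^+ (2 * n) * teich (1 - t) ^+ (2 * n) = - C.
Proof.
have n0 := third_gt0 p_gt3 pE.
rewrite (bigD1 0) //= teich0 expr0n muln_eq0 /= gtn_eqF // mul0r add0r.
rewrite (eq_bigr (fun t => (1 - 2 * n%:R) * (teich t ^+ (2 * n) * (1 - teich t) ^+ (2 * n))
    + 2 * n%:R * (teich t ^+ (2 * n) * (1 - teich t) ^+ (5 * n)))); last first.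
  move=> t t0; rewrite teichB1 -[X in _ * X]exprM.
  have [->|t1] := eqVneq t 1.
    by rewrite teich1 subrr !expr0n !muln_eq0 !(gtn_eqF n0) (gtn_eqF (prime_gt0 p_prime)) /= !mulr0 addr0.
  have ux : 1 - teich t \is a GRing.unit by rewrite -teich1 teichB_unit // eq_sym.
  move: (1 - teich t) ux => x ux.
  have hu : pmult (x ^+ (3 * n) - 1) by rewrite -p_pred; apply: pmult_fermat.
  have -> : x ^+ (p * (2 * n)) = x ^+ (2 * n) * (1 + (x ^+ (3 * n) - 1)) ^+ (2 * n).
    rewrite addrC subrK -exprM -exprD; congr (_ ^+ _); rewrite pE; nia.
  rewrite exprD_pmult // !expr1n natrM (_ : 5 * n = 2 * n + 3 * n)%N ?exprD; last by lia.
  ring.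
rewrite big_split -!mulr_sumr /= sum_teich_2n sum_teich_5n.
transitivity ((p%:R - 1) * (C + 2 * n%:R * (2 * 'C(5 * n, n)%:R - C)) : R); first by ring.
rewrite bin_5n.
transitivity (- C + (p%:R * p%:R) * C); first by ring.
by rewrite sqr_pR // mul0r addr0.
Qed.

End Teichmuller.

(** * The two congruences *)

Section Truncation.

Variable p : nat.
Hypothesis p_prime : prime p.

Lemma coprime_fact m k e : (k < p)%N -> coprime (p ^ m) (k`! ^ e).
Proof.
by move=> kp; rewrite coprimeXl // coprimeXr // prime_coprime // prime_dvd_fact // -ltnNge.
Qed.

Lemma p_dvd_acoef k : (p <= 3 * k)%N -> (k < p)%N -> (p %| acoef k)%N.
Proof.
move=> pk kp; rewrite -(Gauss_dvdl _ (coprime_fact 1 3 kp)) expn1.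
by rewrite acoef_fact prime_dvd_fact.
Qed.

Lemma sqr_dvd_acoef k : (2 * p <= 3 * k)%N -> (k < p)%N -> (p ^ 2 %| acoef k)%N.
Proof.
move=> pk kp; rewrite -(Gauss_dvdl _ (coprime_fact 2 3 kp)) acoef_fact.
apply: (@dvdn_trans (2 * p)`!).
  have /bin_fact <- : (p <= 2 * p)%N by lia.
  have -> : (2 * p - p = p)%N by lia.
  by apply/dvdn_mull/dvdn_mul; rewrite prime_dvd_fact.
have /bin_fact <- := pk.
by rewrite mulnCA dvdn_mulr.
Qed.

(** Either both indices are at least [p / 3] and each factor yields a [p], or one is smaller and the
    other exceeds [2 p / 3]. *)
Lemma sqr_dvd_acoef2 i j : (i < p)%N -> (j < p)%N -> (p <= i + j)%N ->
  (p ^ 2 %| acoef i * acoef j)%N.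
Proof.
move=> ip jp ij; have [i3|i3] := leqP p (3 * i).
  have [j3|j3] := leqP p (3 * j); first by apply: dvdn_mul; apply: p_dvd_acoef.
  by apply/dvdn_mulr/sqr_dvd_acoef; lia.
by apply/dvdn_mull/sqr_dvd_acoef; lia.
Qed.

Lemma sqr_dvd_ccoef k : (p <= 2 * k)%N -> (k < p)%N -> (p ^ 2 %| ccoef k)%N.
Proof.
move=> pk kp; apply: dvdn_mulr; rewrite dvdn_exp2r //.
rewrite -(Gauss_dvdl _ (coprime_fact 1 2 kp)) expn1.
have h : (k <= 2 * k)%N by lia.
have := bin_fact h; have -> : (2 * k - k = k)%N by lia.
by rewrite mulnn => ->; rewrite prime_dvd_fact.
Qed.

Lemma red_dvd0 k : (p ^ 2 %| k)%N -> @red p k%:R 0.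
Proof. by rewrite -natR_eq0 // => /eqP <-; apply: red_nat. Qed.

Local Notation q := (1 - 27 * 'X : {poly rat}).
Local Notation y := ('X * q).

Lemma y_coef_int k m : exists z : int, (y ^+ k)`_m = z%:~R.
Proof.
have -> : y ^+ k = map_poly intr (('X * (1 - 27 * 'X)) ^+ k).
  by rewrite rmorphXn rmorphM rmorphB /= rmorph1 rmorphM rmorph_nat /= map_polyX.
by rewrite coef_map; eexists.
Qed.

Lemma y_coef0 k m : (2 * k < m)%N -> (y ^+ k)`_m = 0.
Proof.
move=> km; apply: nth_default; apply: leq_trans (size_poly_exp_leq _ _) _.
have sq : (size q <= 2)%N.
  apply/leq_sizeP => -[|[|j]] // _.
  by rewrite coefB coef_natM coef1 coefX /= mulr0 subr0.
have sy : (size y <= 3)%N.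
  by apply: leq_trans (size_polyMleq _ _) _; rewrite size_polyX; lia.
apply: leq_ltn_trans km; rewrite leq_mul2r; lia.
Qed.

Lemma red_sum0 (I : Type) (s : seq I) (P : pred I) (f : I -> rat) :
  (forall i, P i -> @red p (f i) 0) -> @red p (\sum_(i <- s | P i) f i) 0.
Proof.
by move=> h; have := red_sum (g := fun=> 0 : zmod_sqr p) s h; rewrite [X in red _ X]big1.
Qed.

(** Below degree [p] this is [clausen_coef]. From degree [p] on, the square only involves products
    [acoef i * acoef j] with [i + j >= p], and [y ^+ k], of degree at most [2 k], only enters with
    [2 k >= p]. *)
Lemma red_clausen_coef m :
  @red p (apoly p ^+ 2 - ysum p (fun k => (ccoef k)%:R))`_m 0.
Proof.
have [mp|pm] := ltnP m p.
  by rewrite coefB clausen_coef // subrr; apply: (red_nat p 0).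
have hA : @red p (apoly p ^+ 2)`_m 0.
  rewrite expr2 coefM; apply: red_sum0 => -[j jm] _ /=.
  rewrite !coef_poly; case: ltnP => [jp|_]; last by rewrite mul0r; apply: (red_nat p 0).
  case: ltnP => [mjp|_]; last by rewrite mulr0; apply: (red_nat p 0).
  by rewrite -natrM; apply/red_dvd0/sqr_dvd_acoef2 => //; lia.
have hB : @red p (ysum p (fun k => (ccoef k)%:R))`_m 0.
  rewrite coef_sum; apply: red_sum0 => -[k kp] _ /=; rewrite coefCM.
  have [km|mk] := ltnP (2 * k) m.
    by rewrite y_coef0 // mulr0; apply: (red_nat p 0).
  have [z ->] := y_coef_int k m.
  rewrite -(mul0r (z%:~R : zmod_sqr p)); apply: redM; last exact: red_int.
  by apply: red_dvd0; apply: sqr_dvd_ccoef => //; lia.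
by have := redB hA hB; rewrite subr0 coefB.
Qed.

Hypothesis p_gt3 : (3 < p)%N.

(** The term ratios match because [27 / 24 = 9 / 8]. *)
Lemma apoly_tau k : (acoef k)%:R * 24^-1 ^+ k = tau (0 : rat) k.
Proof.
elim: k => [|k IH]; first by rewrite tau0 expr0 mulr1.
rewrite tauS -IH exprS.
have k0 : 0 <= k%:R :> rat by [].
have k1 : (k%:R + 1) ^+ 2 != 0 :> rat by rewrite expf_neq0 //; apply/eqP; lra.
apply: (mulfI k1); rewrite (mulrA _ (acoef _)%:R) acoefSr; field.
by apply/eqP; lra.
Qed.

Lemma apoly_horner : (apoly p).[24^-1] = \sum_(k < p) tau (0 : rat) k.
Proof. by rewrite horner_poly; apply: eq_bigr => k _; apply: apoly_tau. Qed.

Lemma y_horner : y.[24^-1] = (- 192)^-1.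
Proof.
rewrite hornerM hornerD hornerN !mulr_natl hornerMn hornerX -polyC1 hornerC.
by field.
Qed.

Lemma ysum_horner f : (ysum p f).[24^-1] = \sum_(k < p) f k / (- 192) ^+ k.
Proof.
rewrite horner_sum; apply: eq_bigr => k _.
by rewrite hornerM hornerC horner_exp y_horner exprVn.
Qed.

(** As 24 is a unit, the coefficientwise vanishing of [D] passes to its value at [1/24], where
    [y = - 1/192]. *)
Lemma red_sum_ccoef :
  @red p (\sum_(k < p) (ccoef k)%:R / (- 192) ^+ k) (tau_sum 0 ^+ 2).
Proof.
rewrite -(ysum_horner (fun k => (ccoef k)%:R)).
set B := ysum _ _; pose D := apoly p ^+ 2 - B.
have hD : @red p D.[24^-1] 0.
  rewrite horner_coef; apply: red_sum0 => i _.
  rewrite -(mul0r (24^-1 ^+ i : zmod_sqr p)); apply: redM; first exact: red_clausen_coef.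
  by apply/red_exp/redV; [apply: red_nat | apply: unitR24].
have hA : @red p (apoly p).[24^-1] (tau_sum 0).
  have := red_tau_sum p_prime p_gt3 0; rewrite !mul0r.
  by rewrite apoly_horner.
have -> : B.[24^-1] = (apoly p).[24^-1] ^+ 2 - D.[24^-1].
  by rewrite hornerD hornerN horner_exp opprB addrCA subrr addr0.
by have := redB (red_exp 2 hA) hD; rewrite subr0.
Qed.

End Truncation.

(** Composition of forms: [16 p ^ 2 = (x a + 27 y b) ^ 2 + 27 (x b - a y) ^ 2]. If
    [x b - a y = q p], then [27 q ^ 2 <= 16], so [q = 0], which forces [b ^ 2 = y ^ 2]. *)
Lemma cubic_form_unique_aux (p : nat) (x y a b : int) : prime p ->
  4 * p%:Z = x ^+ 2 + 27 * y ^+ 2 -> 4 * p%:Z = a ^+ 2 + 27 * b ^+ 2 ->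
  (p%:Z %| x * b - a * y)%Z -> x ^+ 2 = a ^+ 2.
Proof.
move=> p_prime ex ea /dvdzP[q eq].
have p0 := prime_gt0 p_prime.
have e16 : 16 * p%:Z ^+ 2 = (x * a + 27 * y * b) ^+ 2 + 27 * (q * p%:Z) ^+ 2.
  rewrite -eq; transitivity ((4 * p%:Z) * (4 * p%:Z)); first by ring.
  by rewrite {1}ex ea; ring.
have q0 : q = 0.
  have h : 27 * q ^+ 2 * p%:Z ^+ 2 <= 16 * p%:Z ^+ 2.
    have -> : 27 * q ^+ 2 * p%:Z ^+ 2 = 27 * (q * p%:Z) ^+ 2 by ring.
    by rewrite e16 lerDr sqr_ge0.
  have p2 : 0 < p%:Z ^+ 2 by rewrite exprn_gt0.
  rewrite ler_pM2r // in h.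
  apply/eqP; apply: contraTT h => q0; rewrite -ltNge.
  have : 0 < q ^+ 2 by rewrite exprn_even_gt0.
  by lia.
have xb : x * b = a * y by apply/eqP; rewrite -subr_eq0 eq q0 mul0r.
have by2 : b ^+ 2 = y ^+ 2.
  have p4 : 4 * p%:Z != 0 by lia.
  apply: (mulfI p4); rewrite {1}ex ea.
  apply/eqP; rewrite -subr_eq0; apply/eqP.
  transitivity ((x * b - a * y) * (x * b + a * y)); first by ring.
  by rewrite xb subrr mul0r.
have : x ^+ 2 + 27 * y ^+ 2 = a ^+ 2 + 27 * b ^+ 2 by rewrite -ex.
by rewrite by2 => /addIr.
Qed.

(** [p] divides [(x b - a y) (x b + a y)]; changing the sign of [y] reduces the second factor to the
    first. *)
Lemma cubic_form_unique (p : nat) (x y a b : int) : prime p ->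
  4 * p%:Z = x ^+ 2 + 27 * y ^+ 2 -> 4 * p%:Z = a ^+ 2 + 27 * b ^+ 2 ->
  x ^+ 2 = a ^+ 2.
Proof.
move=> p_prime ex ea.
have : (p%:Z %| (x * b - a * y) * (x * b + a * y))%Z.
  apply/dvdzP; exists (4 * (b ^+ 2 - y ^+ 2)).
  transitivity ((4 * p%:Z) * b ^+ 2 - (4 * p%:Z) * y ^+ 2); last by ring.
  by rewrite {1}ex ea; ring.
rewrite dvdzE abszM Euclid_dvdM // => /orP[h|h].
  exact: (cubic_form_unique_aux p_prime ex ea).
apply: (@cubic_form_unique_aux p x (- y) a b) => //; first by rewrite sqrrN.
by rewrite mulrN opprK dvdzE.
Qed.

Section Assembly.

Variables (p n : nat).
Hypothesis p_prime : prime p.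
Hypothesis p_gt3 : (3 < p)%N.
Hypothesis pE : p = (3 * n + 1)%N.

(** With [J' = - C] a unit, [J J' = p] makes [J] a multiple of [p], so [J ^+ 2 = 0]. Expanding
    [A ^+ 2 = (J + J') ^+ 2] gives [C ^+ 2 = A ^+ 2 - 2 p], and [cubic_form_unique] replaces
    [A ^+ 2] by [x ^+ 2]. *)
Lemma binom_sqr (x y : int) : 4 * p%:Z = x ^+ 2 + 27 * y ^+ 2 ->
  ('C(2 * n, n)%:R : zmod_sqr p) ^+ 2 = x%:~R ^+ 2 - 2 * p%:R.
Proof.
move=> exy.
have n0 := third_gt0 p_gt3 pE.
have cardF : #|'F_p| = (3 * n).+1 by rewrite card_Fp // pE addn1.
have [|t0 t00 z1] := @exists_Fp_expn_neq1 p p_prime n; first by rewrite (p_pred pE); lia.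
have [A [B [eAB JA]]] := cubic_jacobi_form cardF t00 z1.
rewrite card_Fp // in eAB.
have eA := cubic_form_unique p_prime exy eAB.
pose w : zmod_sqr p := teich t0 ^+ n.
have w_root : 1 + w + w ^+ 2 = 0.
  have uw : w - 1 \is a GRing.unit.
    by rewrite /w -teichX // -(teich1 p_prime) teichB_unit.
  apply: (mulrI uw); rewrite mulr0.
  transitivity (w ^+ 3 - 1); first by ring.
  by rewrite /w -exprM -teichX // mulnC -(p_pred pE) Fp_pred // teich1 // subrr.
(* The Teichmueller lift of [t ^+ n] realises the abstract cubic character modulo [p ^ 2]. *)
have charE (t : 'F_p) : cubic_char n t0 w t = teich t ^+ n.
  rewrite /cubic_char; have [->|tn0] := eqVneq t 0.
    by rewrite teich0 // expr0n gtn_eqF.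
  rewrite /w -exprM -!teichX // exprM.
  by rewrite (cubic_classP cardF t00 z1).
have J2 : jacobi (cubic_char n t0 (w ^+ 2)) = - 'C(2 * n, n)%:R.
  rewrite -(teich_jacobi p_prime p_gt3 pE) /jacobi; apply: eq_bigr => t _.
  by rewrite !cubic_charX2 // !charE mulnC !exprM.
have := jacobi_cubic_norm cardF t00 z1 w_root (unitR3 p_prime p_gt3).
have := JA _ w w_root; rewrite J2.
move: (jacobi _) => J sJ nJ.
rewrite card_Fp // in nJ.
have uC : ('C(2 * n, n)%:R : zmod_sqr p) \is a GRing.unit.
  have := unit_fact p_prime (_ : 2 * n < p)%N.
  move=> /(_ ltac:(lia)); rewrite fact_2n // unitrM => /andP[] //.
have J1 : J ^+ 2 = 0.
  apply: pmult_sqr => //; exists (- 'C(2 * n, n)%:R^-1).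
  by rewrite -nJ -mulrA mulrNN divrr // mulr1.
have -> : x%:~R ^+ 2 = A%:~R ^+ 2 :> zmod_sqr p.
  by rewrite -!rmorphXn eA.
rewrite -sJ.
transitivity (J ^+ 2 + 2 * (J * - 'C(2 * n, n)%:R) + 'C(2 * n, n)%:R ^+ 2
  - 2 * p%:R : zmod_sqr p); last by ring.
by rewrite nJ J1; ring.
Qed.

End Assembly.

Theorem corollary1 (p : nat) (p_prime : prime p) (p_gt3 : (3 < p)%N) :
  ((p = 1 %[mod 3])%N ->
     forall x y : int, 4 * p%:Z = x ^+ 2 + 27 * y ^+ 2 ->
     Zloc_congr p (p ^ 2)%N
       (\sum_(0 <= k < p)
          ('C(2 * k, k)%:R ^+ 2 * 'C(3 * k, k)%:R) / (- 192) ^+ k)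
       (x%:~R ^+ 2 - 2 * p%:R))
  /\
  ((p = 2 %[mod 3])%N ->
     Zloc_congr p (p ^ 2)%N
       (\sum_(0 <= k < p)
          ('C(2 * k, k)%:R ^+ 2 * 'C(3 * k, k)%:R) / (- 192) ^+ k)
       0).
Proof.
have sumE : \sum_(0 <= k < p) ('C(2 * k, k)%:R ^+ 2 * 'C(3 * k, k)%:R) / (- 192) ^+ k
    = \sum_(k < p) (ccoef k)%:R / (- 192) ^+ k :> rat.
  by rewrite big_mkord; apply: eq_bigr => k _; rewrite /ccoef natrM natrX.
have h := red_sum_ccoef p_prime p_gt3.
rewrite sumE; split=> [p1 x y exy|p2]; apply: (red_congr p_prime h).
  have pE : p = (3 * (p %/ 3) + 1)%N by rewrite {1}(divn_eq p 3) p1 mulnC.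
  rewrite (tau_sum_binom p_prime p_gt3 pE) (binom_sqr p_prime p_gt3 pE exy).
  apply: redB; first by apply/red_exp/red_int.
  by apply: redM; apply: red_nat.
have pE : p = (3 * (p %/ 3) + 2)%N by rewrite {1}(divn_eq p 3) p2 mulnC.
rewrite (pmult_sqr p_prime (tau_sum_pmult p_prime p_gt3 pE)).
exact: (red_nat p 0).
Qed.
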